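(* Suppose that the following conditions hold. (1) The frequency density function $g=g(\omega)$ and the coupling strength $K$ satisfy $$\operatorname{supp} g\subset(-M,M),\qquad K>\frac{M}{\varepsilon_0}\Big(1+\frac1{\varepsilon_0}\Big),\qquad \varepsilon_0\in\Big(0,\frac{3\sqrt3}{4}-1\Big).$$ (2) The initial datum $f_0$ satisfies (i) $f_0(\theta,\omega)=0$ in $\mathbb T\times(\mathbb R\setminus[-M,M])$ and $\|f_0\|_{L^\infty}<\infty$; (ii) $$\iint_{L^+_{\gamma_0}(0)\times\mathbb R}f_0(\theta,\omega)\,d\theta\,d\omega\ \ge\ \mathcal M_*(\varepsilon_0,\gamma_0):=\frac{2+\varepsilon_0+\cos\gamma_0}{(1+\sin\gamma_0)(1+\cos\gamma_0)},$$ where $\gamma_0$ satisfies $$\frac{\pi}{3}\le\gamma_0<\arcsin\Big(1-\frac{2\varepsilon_0}{2\sqrt3+1}\Big).$$ Then, for any $C^1$-solution $f$ of the Kuramoto-Sakaguchi equation with initial datum $f_0$, there exists a time-dependent interval $L(t)\subset\mathbb T$ centered around $\phi(t)$, with fixed width, such that $$\frac{d}{dt}\iint_{L(t)\times\mathbb R}f(\theta,\omega,t)\,d\theta\,d\omega\ge0,\qquad \int_{L(t)}|f(\theta,\omega,t)|^2\,d\theta\ \ge\ Ce^{Ct},\quad \omega\in\operatorname{supp}g,$$ where $C$ denotes a positive constant.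
   Context: $\mathbb T=\mathbb R/(2\pi\mathbb Z)$. $g\ge0$ is a compactly supported probability density on $\mathbb R$ with $\int_{\mathbb R}\omega g(\omega)\,d\omega=0$, $M>0$, and $K>0$ is the coupling strength. The Kuramoto-Sakaguchi equation for the probability density $f=f(\theta,\omega,t)\ge0$ on $\mathbb T\times\mathbb R$, $t>0$, is $$\partial_tf+\partial_\theta(v[f]f)=0,\qquad v[f](\theta,\omega,t)=\omega-K\int_{\mathbb T}\sin(\theta-\theta_* )\rho(\theta_*,t)\,d\theta_*,\qquad \rho(\theta,t)=\int_{\mathbb R}f(\theta,\omega,t)\,d\omega,$$ with initial datum $f(\theta,\omega,0)=f_0(\theta,\omega)$, $\int_{\mathbb T}f_0(\theta,\omega)\,d\theta=g(\omega)$. The order parameters $R(t)$ and $\phi(t)$ are defined by $R(t)e^{\mathrm i\phi(t)}=\iint_{\mathbb T\times\mathbb R}e^{\mathrm i\theta}f(\theta,\omega,t)\,d\theta\,d\omega$; the average phase $\phi(t)$ is well defined (mod $2\pi$) when $R(t)>0$. For a constant $\gamma$, $L^+_\gamma(t)=\big(\phi(t)-\frac\pi2+\gamma,\ \phi(t)+\frac\pi2-\gamma\big)\subset\mathbb T$.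
   Formalization: The L² bound is stated for ω with g(ω)≠0 rather than the closed support, as c·e^{Ct} with C uniform but c depending on ω, for all t≥0 if f0(·,ω) is not null on L(0), and otherwise only from some time T(ω) on; the literal bound is false. *)

(* Defs.v *)
From mathcomp Require Import all_boot all_order all_algebra.
From mathcomp Require Import all_classical all_reals all_analysis.
Set Implicit Arguments.
Unset Strict Implicit.
Unset Printing Implicit Defensive.
Import Order.TTheory GRing.Theory Num.Theory.
Import numFieldNormedType.Exports.
Local Open Scope classical_set_scope.
Local Open Scope ring_scope.

Section KuramotoSakaguchi.
Context {R : realType}.
Implicit Types (g : R -> R) (f : R -> R -> R -> R).
Implicit Types (A : set R) (K theta omega t phi gamma : R).

Local Notation leb := (@lebesgue_measure R).
(* Product measure d(theta) d(omega). *)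
Local Notation leb2 := (leb \x leb)%E.

(** A function on the torus is a 2pi-periodic function on R, integrated over
    the fundamental domain below.  An arc of the torus of length at most 2pi is
    represented by any of its lifts to a real interval; by periodicity the
    integrals do not depend on the lift. *)
Definition torus : set R := `[0, 2 * pi[.

Definition circle_arc (c l : R) : set R := `]c - l, c + l[.

(** The arc L^+_gamma, as a function of the average phase phi. *)
Definition Lplus gamma phi : set R := circle_arc phi (pi / 2 - gamma).

(** Topological support (a closed set). *)
Definition supp g : set R := closure [set omega | g omega != 0].

Record frequency_density g : Prop := FrequencyDensity {
  freq_ge0 : forall omega, 0 <= g omega;
  freq_meas : measurable_fun setT g;
  freq_compact : compact (supp g);
  freq_mass1 : (\int[leb]_(omega in setT) (g omega)%:E = 1)%E;
  freq_mean0 : (\int[leb]_(omega in setT) (omega * g omega)%:E = 0)%E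
}.

(** Essentially bounded on T x R; for a function that is periodic in theta the
    norm over R x R is the norm over T x R. *)
Definition Linfty_bounded (f0 : R -> R -> R) : Prop :=
  (Lnorm leb2 +oo (fun p : R * R => (f0 p.1 p.2)%:E) < +oo)%E.

Definition local_density f theta t : R :=
  \int[leb]_(omega in setT) f theta omega t.

Definition velocity K f theta omega t : R :=
  omega - K * \int[leb]_(s in torus) (sin (theta - s) * local_density f s t).

(** [mass f A t] is the integral of f(., ., t) over A x R. *)
Definition mass f A t : R :=
  \int[leb2]_(p in A `*` setT) f p.1 p.2 t.

(** Real and imaginary parts of the complex order parameter R e^{i phi}. *)
Definition order_re f t : R :=
  \int[leb2]_(p in torus `*` setT) (cos p.1 * f p.1 p.2 t).

Definition order_im f t : R :=
  \int[leb2]_(p in torus `*` setT) (sin p.1 * f p.1 p.2 t).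

Definition order_amplitude f t : R :=
  Num.sqrt (order_re f t ^+ 2 + order_im f t ^+ 2).

(** phi determines the average phase modulo 2pi when the amplitude is positive,
    and is unconstrained when the amplitude vanishes. *)
Definition is_average_phase f t phi : Prop :=
  order_re f t = order_amplitude f t * cos phi /\
  order_im f t = order_amplitude f t * sin phi.

Definition d_theta f theta omega t : R :=
  (fun s : R => f s omega t)^`()%classic theta.
Definition d_omega f theta omega t : R :=
  (fun s : R => f theta s t)^`()%classic omega.
Definition d_t f theta omega t : R :=
  (fun s : R => f theta omega s)^`()%classic t.

Definition uncurry3 f (p : R * R * R) : R := f p.1.1 p.1.2 p.2.

(** Of class C^1 on R x R x (0, oo) and continuous on R x R x [0, oo). *)
Record C1_positive_time f : Prop := C1PositiveTime {
  C1_continuous0 :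
    {within [set p : R * R * R | 0 <= p.2], continuous (uncurry3 f)};
  C1_derivable : forall theta omega t, 0 < t ->
    [/\ derivable (fun s : R => f s omega t) theta 1,
        derivable (fun s : R => f theta s t) omega 1 &
        derivable (fun s : R => f theta omega s) t 1];
  C1_continuous_partials : forall p : R * R * R, 0 < p.2 ->
    [/\ {for p, continuous (uncurry3 (d_theta f))},
        {for p, continuous (uncurry3 (d_omega f))} &
        {for p, continuous (uncurry3 (d_t f))}]
}.

(** C^1 solutions of the Kuramoto-Sakaguchi equation with initial datum f0
    whose theta-marginal is g. *)
Record KS_C1_solution K g (f0 : R -> R -> R) f : Prop := KSC1Solution {
  KS_periodic : forall theta omega t, 0 <= t ->
    f (theta + 2 * pi) omega t = f theta omega t;
  KS_ge0 : forall theta omega t, 0 <= t -> 0 <= f theta omega t;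
  KS_mass1 : forall t, 0 <= t ->
    (\int[leb2]_(p in torus `*` setT) (f p.1 p.2 t)%:E = 1)%E;
  KS_C1 : C1_positive_time f;
  KS_equation : forall theta omega t, 0 < t ->
    d_t f theta omega t
    + d_theta (fun s w r => velocity K f s w r * f s w r) theta omega t = 0;
  KS_initial : forall theta omega, f theta omega 0 = f0 theta omega;
  KS_marginal : forall omega,
    (\int[leb]_(theta in torus) (f0 theta omega)%:E = (g omega)%:E)%E
}.

Definition initial_mass (f0 : R -> R -> R) A : R :=
  \int[leb2]_(p in A `*` setT) f0 p.1 p.2.

(** The threshold M_* for the initial mass. *)
Definition Mstar (eps0 gamma0 : R) : R :=
  (2 + eps0 + cos gamma0) / ((1 + sin gamma0) * (1 + cos gamma0)).

(** The integral of |f(., omega, t)|^2 over A. *)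
Definition L2_mass f A omega t : R :=
  \int[leb]_(theta in A) (`|f theta omega t| ^+ 2).

(** [L2_growth f L C omega]: the lower bound c e^{Ct} holds for every t >= 0 as
    soon as f(., omega, 0) does not vanish identically on L 0.  If it does
    vanish there, the bound is false for small t (the speed of propagation is
    finite), and is required from some time T on. *)
Definition L2_growth f (L : R -> set R) (C omega : R) : Prop :=
  exists c T : R,
    [/\ 0 < c, 0 <= T, 0 < L2_mass f (L 0) omega 0 -> T = 0 &
        forall t, T <= t -> c * expR (C * t) <= L2_mass f (L t) omega t].

End KuramotoSakaguchi.

(* Main.v *)
(** The marginal in [theta] is transported by a periodic flux, so [f] vanishes for
    [omega] outside the support of [g]; hence every integral below is over a compact
    rectangle.  In the frame of the average phase, [s = theta - phi], the velocity is
    [omega - phi' - K R sin s], and since [sin s] has mean zero,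
    [R |phi'| <= M + K R (1 - R)].  If [R (1 + cos gamma0) >= 1 + e] then at the ends
    [s = +- l], [l = pi / 2 - gamma0], of the arc one gets
    [K R cos gamma0 - |omega - phi'| >= K e - M - M / eps0], so both fluxes point into the
    arc.  Conversely [1 + R >= (1 + sin gamma0) m] for the mass [m] of the arc, so
    [m >= Mstar] gives [e = eps0]; a continuity argument closes the loop, as the flux
    condition still holds for some [e < eps0].

    For fixed [omega], [f^2] satisfies the same equation with source [K R (cos s) f^2], so
    its integral over the arc grows exponentially once it is positive.  It becomes
    positive: on the antipodal arc the same computation gives exponential decay, and
    between the two arcs all mass drifts towards [phi] at a uniform rate, so that
    otherwise [int (cos s) f] would be unbounded. *)
Require Import Defs.
From mathcomp Require Import all_boot all_order all_algebra.
From mathcomp Require Import ring lra.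
From mathcomp Require Import all_classical all_reals all_analysis.
From mathcomp Require Import measurable_realfun.
Import Order.TTheory GRing.Theory Num.Theory.
Import numFieldNormedType.Exports.
Local Open Scope classical_set_scope.
Local Open Scope ring_scope.

(** * Continuity and derivatives *)

Section Continuity.
Context {R : realType} {X : topologicalType}.
Implicit Types (f g : X -> R) (x : X).

(** The solution is [C^1] only at positive times and merely continuous at time 0, where the
    bootstrap and the growth estimates start. Time is therefore reflected evenly, which makes
    continuity two-sided, and derivatives are asked for at positive times only. The selection [phi]
    may jump by multiples of [2 * pi], so [phi] itself is never differentiated: only integrals of
    the periodic solution over arcs around [phi t] are, and these do not see the jumps. The mass
    threshold controls an average over [omega]. For a single [omega] the density may vanish on the
    arc at first, and a differential inequality [y' >= C y] is satisfied by zero. This is why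
    positivity on the arc needs an argument of its own, and why the prefactor and the waiting time
    depend on [omega] while the rate does not. *)

Lemma continuous_at_cst {Y : topologicalType} (c : Y) x : continuous_at x (fun=> c).
Proof. exact: cvg_cst. Qed.

Lemma continuous_at_id x : continuous_at x (fun z => z).
Proof. exact: cvg_id. Qed.

Lemma continuous_atD f g x : continuous_at x f -> continuous_at x g ->
  continuous_at x (fun z => f z + g z).
Proof. by move=> cf cg; apply: cvgD. Qed.

Lemma continuous_atN f x : continuous_at x f -> continuous_at x (fun z => - f z).
Proof. by move=> cf; apply: cvgN. Qed.

Lemma continuous_atM f g x : continuous_at x f -> continuous_at x g ->
  continuous_at x (fun z => f z * g z).
Proof. by move=> cf cg; apply: cvgM. Qed.

Lemma continuous_atX f n x : continuous_at x f -> continuous_at x (fun z => f z ^+ n).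
Proof.
move=> cf; elim: n => [|n IH]; first exact: continuous_at_cst.
by under [X in continuous_at _ X]eq_fun do rewrite exprS; exact: continuous_atM.
Qed.

Lemma continuous_atV f x : f x != 0 -> continuous_at x f ->
  continuous_at x (fun z => (f z)^-1).
Proof. by move=> f0 cf; apply: cvgV. Qed.

Lemma continuous_at_comp {Y Z : topologicalType} (h : X -> Y) (k : Y -> Z) x :
  continuous_at x h -> continuous_at (h x) k -> continuous_at x (fun z => k (h z)).
Proof. by move=> ch ck; apply: (continuous_comp ch). Qed.

Lemma continuous_at_sin f x : continuous_at x f -> continuous_at x (fun z => sin (f z)).
Proof. by move=> cf; apply: continuous_at_comp => //; exact: continuous_sin. Qed.

Lemma continuous_at_cos f x : continuous_at x f -> continuous_at x (fun z => cos (f z)).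
Proof. by move=> cf; apply: continuous_at_comp => //; exact: continuous_cos. Qed.

Lemma continuous_at_pair {Y Z : topologicalType} (h : X -> Y) (k : X -> Z) x :
  continuous_at x h -> continuous_at x k -> continuous_at x (fun z => (h z, k z)).
Proof. by move=> ch ck; apply: cvg_pair. Qed.

Lemma continuous_at_fst {Y Z : topologicalType} (h : X -> Y * Z) x :
  continuous_at x h -> continuous_at x (fun z => (h z).1).
Proof. by move=> ch; apply: (continuous_at_comp h fst) => //; exact: cvg_fst. Qed.

Lemma continuous_at_snd {Y Z : topologicalType} (h : X -> Y * Z) x :
  continuous_at x h -> continuous_at x (fun z => (h z).2).
Proof. by move=> ch; apply: (continuous_at_comp h snd) => //; exact: cvg_snd. Qed.

Lemma continuous_at_norm f x : continuous_at x f -> continuous_at x (fun z => `|f z|).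
Proof. by move=> cf; apply: cvg_norm. Qed.

End Continuity.

Ltac continuity_leaf := first [
  match goal with
  | H : continuous_at ?x ?F |- continuous_at ?x ?F => exact H
  | H : {for ?x, continuous ?F} |- continuous_at ?x ?F => exact H
  | H : continuous ?F |- continuous_at ?x ?F => exact (H x)
  end |exact: continuous_at_cst | exact: continuous_at_id | exact: cvg_fst | exact: cvg_snd
  | exact: (continuous_atN (fun z => z) _ (continuous_at_id _))
  | exact: (continuous_at_norm (fun z => z) _ (continuous_at_id _))
  | exact: continuous_sin | exact: continuous_cos |
  match goal with
  | H : continuous_at _ _ |- _ => exact: H
  | H : {for _, continuous _} |- _ => exact: H
  | H : continuous _ |- _ => exact: H
  end | idtac ].

(** The recursion follows the syntax of the function, so that unification never has to guess a
    decomposition. A leaf that nothing closes is left as a goal for the caller. *)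
Ltac continuity := lazymatch goal with
  | |- continuous_at _ (fun z => (@?f z) + (@?g z)) => apply: continuous_atD; continuity
  | |- continuous_at _ (fun z => - (@?f z)) => apply: continuous_atN; continuity
  | |- continuous_at _ (fun z => (@?f z) ^+ _) => apply: continuous_atX; continuity
  | |- continuous_at _ (fun z => (@?f z) * (@?g z)) => apply: continuous_atM; continuity
  | |- continuous_at _ (fun z => sin (@?f z)) => apply: continuous_at_sin; continuity
  | |- continuous_at _ (fun z => cos (@?f z)) => apply: continuous_at_cos; continuity
  | |- continuous_at _ (fun z => `|@?f z|) => apply: continuous_at_norm; continuity
  | |- continuous_at _ (fun z => (@?f z, @?g z)) => apply: continuous_at_pair; continuity
  | |- continuous_at _ (fun z => (@?f z).1) => apply: continuous_at_fst; continuity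
  | |- continuous_at _ (fun z => (@?f z).2) => apply: continuous_at_snd; continuity
  | |- {for _, continuous _} => red; continuity
  | |- continuous _ => let z := fresh "z" in move=> z; continuity
  | _ => continuity_leaf
  end.

Lemma continuous_at_curry2 {R : realType} {X Y Z : topologicalType}
    (F : Y -> Z -> R) (a : X -> Y) (b : X -> Z) x :
  {for (a x, b x), continuous (fun p => F p.1 p.2)} -> continuous_at x a ->
  continuous_at x b -> continuous_at x (fun z => F (a z) (b z)).
Proof.
move=> cF ca cb.
exact: (continuous_at_comp (fun z => (a z, b z)) (fun p => F p.1 p.2) x
  (continuous_at_pair _ _ _ ca cb) cF).
Qed.

Lemma continuous_at_curry3 {R : realType} {X : topologicalType}
    (F : R -> R -> R -> R) (a b c : X -> R) x :
  {for (a x, b x, c x), continuous (uncurry3 F)} -> continuous_at x a ->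
  continuous_at x b -> continuous_at x c ->
  continuous_at x (fun z => F (a z) (b z) (c z)).
Proof.
move=> cF ca cb cc.
exact: (continuous_at_comp (fun z => (a z, b z, c z)) (uncurry3 F) x
  (continuous_at_pair _ _ _ (continuous_at_pair _ _ _ ca cb) cc) cF).
Qed.

(* Sealing [is_derive] keeps unification and instance resolution first-order. *)
Definition has_deriv {R : realType} (f : R -> R) (x l : R) : Prop :=
  is_derive x (1 : R) f l.

Section Derivatives.
Context {R : realType}.
Implicit Types (f g : R -> R) (x c df dg : R).

Lemma has_deriv_cst c x : has_deriv (fun=> c) x 0.
Proof. exact: is_derive_cst. Qed.

Lemma has_deriv_id x : has_deriv (fun z => z) x 1.
Proof. exact: is_derive_id. Qed.

Lemma has_derivD f g x df dg : has_deriv f x df -> has_deriv g x dg ->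
  has_deriv (fun z => f z + g z) x (df + dg).
Proof. by move=> hf hg; apply: is_deriveD. Qed.

Lemma has_derivN f x df : has_deriv f x df ->
  has_deriv (fun z => - f z) x (- df).
Proof. by move=> hf; apply: is_deriveN. Qed.

Lemma has_derivM f g x df dg : has_deriv f x df -> has_deriv g x dg ->
  has_deriv (fun z => f z * g z) x (df * g x + f x * dg).
Proof.
move=> hf hg; have -> : df * g x + f x * dg = f x *: dg + g x *: df.
  by rewrite addrC [df * _]mulrC.
exact: is_deriveM.
Qed.

Lemma has_derivZ c f x df : has_deriv f x df ->
  has_deriv (fun z => c * f z) x (c * df).
Proof. by move=> hf; apply: (is_derive_eq (has_derivM _ _ _ _ _ (has_deriv_cst c x) hf)); ring. Qed.

Lemma has_deriv_comp f g x df dg : has_deriv g x dg ->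
  has_deriv f (g x) df ->
  has_deriv (fun z => f (g z)) x (df * dg).
Proof. by move=> hg hf; exact: (is_derive1_comp hf hg). Qed.

Lemma has_deriv_shift f c x df : has_deriv f (x + c) df ->
  has_deriv (fun z => f (z + c)) x df.
Proof.
move=> hf; have hg := has_derivD _ _ _ _ _ (has_deriv_id x) (has_deriv_cst c x).
by have := has_deriv_comp _ _ _ _ _ hg hf; rewrite addr0 mulr1.
Qed.

Lemma has_deriv_sin f x df : has_deriv f x df ->
  has_deriv (fun z => sin (f z)) x (cos (f x) * df).
Proof. by move=> hf; apply: has_deriv_comp hf _; exact: is_derive_sin. Qed.

Lemma has_deriv_cos f x df : has_deriv f x df ->
  has_deriv (fun z => cos (f z)) x (- sin (f x) * df).
Proof. by move=> hf; apply: has_deriv_comp hf _; exact: is_derive_cos. Qed.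

Lemma has_deriv_near f g x df : (\forall s \near x, f s = g s) ->
  has_deriv f x df -> has_deriv g x df.
Proof. exact: near_eq_is_derive. Qed.

Lemma continuous_at_near f g x : (\forall s \near x, f s = g s) ->
  continuous_at x f -> continuous_at x g.
Proof.
move=> fg cf; rewrite /continuous_at -(nbhs_singleton fg).
by apply: cvg_trans cf; apply: near_eq_cvg.
Qed.

Lemma has_deriv_derive1 f x df : has_deriv f x df ->
  derivable f x 1 /\ f^`()%classic x = df.
Proof. by move=> [d e]; split => //; rewrite derive1E. Qed.

End Derivatives.

(** * Integrals over compact intervals *)

Section IntervalIntegral.
Context {R : realType}.
Implicit Types (a b c x y : R) (F G : R -> R).
Local Notation leb := (@lebesgue_measure R).

Definition itg a b F : R := \int[leb]_(x in `[a, b]) F x.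

Lemma itg_integrable a b F : continuous F ->
  leb.-integrable `[a, b] (EFin \o F).
Proof.
move=> cF; apply: continuous_compact_integrable; first exact: segment_compact.
exact: continuous_subspaceT.
Qed.

Lemma eq_itg a b F G : (forall x, a <= x <= b -> F x = G x) ->
  itg a b F = itg a b G.
Proof.
by move=> FG; apply: eq_Rintegral => x; rewrite inE/= in_itv/= => /FG.
Qed.

Lemma itgD a b F G : continuous F -> continuous G ->
  itg a b (fun x => F x + G x) = itg a b F + itg a b G.
Proof.
by move=> cF cG; apply: RintegralD => //; apply: itg_integrable.
Qed.

Lemma itgB a b F G : continuous F -> continuous G ->
  itg a b (fun x => F x - G x) = itg a b F - itg a b G.
Proof.
by move=> cF cG; apply: RintegralB => //; apply: itg_integrable.
Qed.

Lemma itgZ a b c F : continuous F ->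
  itg a b (fun x => c * F x) = c * itg a b F.
Proof. by move=> cF; apply: RintegralZl => //; apply: itg_integrable. Qed.

Lemma itg_cst a b c : a <= b -> itg a b (fun=> c) = c * (b - a).
Proof.
move=> ab; rewrite /itg Rintegral_cst//=.
rewrite [X in fine X](@lebesgue_measure_itv R `[a, b])/= lte_fin.
by have [//|ba|->] := ltgtP a b; rewrite ?subrr//; move: ab; rewrite leNgt ba.
Qed.

Lemma le_itg a b F G : continuous F -> continuous G ->
  (forall x, a <= x <= b -> F x <= G x) -> itg a b F <= itg a b G.
Proof.
move=> cF cG FG; apply: le_Rintegral; rewrite ?set_itvcc//;
  try by rewrite -set_itvcc; exact: itg_integrable.
by rewrite -set_itvcc.
Qed.

Lemma itg_ge0 a b F : (forall x, a <= x <= b -> 0 <= F x) -> 0 <= itg a b F.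
Proof.
by move=> F0; apply: Rintegral_ge0 => x; rewrite /= in_itv/=; apply: F0.
Qed.

Lemma itg_eqfun0 a b F : (forall x, a <= x <= b -> F x = 0) -> itg a b F = 0.
Proof.
move=> F0; rewrite (@eq_itg _ _ _ (fun=> 0))//; have [ab|ab] := leP a b.
  by rewrite itg_cst ?mul0r.
by rewrite /itg set_itv_ge ?Rintegral_set0// bnd_simp -ltNge.
Qed.

Lemma normr_itg_le a b F c : continuous F -> a <= b ->
  (forall x, a <= x <= b -> `|F x| <= c) -> `|itg a b F| <= c * (b - a).
Proof.
move=> cF ab Fc; rewrite ler_norml -mulNr -!itg_cst//.
apply/andP; split; apply: le_itg => //; try by move=> x; exact: cvg_cst.
  by move=> x /Fc; rewrite ler_norml => /andP[].
by move=> x /Fc; rewrite ler_norml => /andP[].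
Qed.

Lemma itg_chasles a b c F : continuous F -> a <= b <= c ->
  itg a c F = itg a b F + itg b c F.
Proof.
move=> cF /andP[ab bc]; rewrite /itg.
rewrite -(@Rintegral_itv_obnd_cbnd _ b (BRight c)); last first.
  apply: integrableS (itg_integrable b c F cF) => //.
  by apply: subset_itvr; rewrite bnd_simp.
rewrite -(@Rintegral_itvB _ _ (BLeft a) (BRight c) b) ?bnd_simp//.
  by rewrite addrC subrK.
exact: itg_integrable.
Qed.

Lemma itg_FTC a b F G : a <= b -> continuous F ->
  (forall x, a <= x <= b -> has_deriv G x (F x)) -> itg a b F = G b - G a.
Proof.
move=> ab cF dG.
case: (ltgtP a b) ab => // [ab _|-> _]; last first.
  by rewrite subrr /itg set_itv1 Rintegral_set1.
have cG x : a <= x <= b -> G @ x --> G x.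
  move=> /dG[dGx _].
  by apply: differentiable_continuous; apply/derivable1_diffP.
rewrite /itg /Rintegral (@continuous_FTC2 _ _ G)//=.
- exact: continuous_subspaceT.
- split.
  + by move=> x; rewrite in_itv/= => /andP[/ltW ax /ltW xb];
      have [] := dG x; rewrite ?ax.
  + by apply: cvg_at_right_filter; apply: cG; rewrite lexx ltW.
  + by apply: cvg_at_left_filter; apply: cG; rewrite lexx ltW.
- move=> x; rewrite in_itv/= => /andP[/ltW ax /ltW xb].
  by have [] := dG x; rewrite ?ax// derive1E => _ ->.
Qed.

Lemma primitive_right a F : continuous F ->
  exists G, forall x, a < x -> has_deriv G x (F x).
Proof.
move=> cF; exists (fun x => itg a x F) => x ax.
have xx1 : x < x + 1 by rewrite ltrDl.
have [d e] := continuous_FTC1_closed xx1 (itg_integrable a (x + 1) F cF) ax (cF x).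
by split; [exact: d | rewrite -e derive1E].
Qed.

Lemma itg_shift a b c F : a <= b -> continuous F ->
  itg a b (fun x => F (x + c)) = itg (a + c) (b + c) F.
Proof.
(* The base point lies one unit to the left of the interval, so that the primitive is differentiable
   at the left end as well. *)
move=> ab cF; have [G dG] := primitive_right (a + c - 1) F cF.
have -> : itg (a + c) (b + c) F = G (b + c) - G (a + c).
  apply: itg_FTC; rewrite ?lerD2r// => x /andP[ax _]; apply: dG.
  by apply: lt_le_trans ax; rewrite ltrBlDr ltrDl.
apply: (@itg_FTC a b _ (fun x => G (x + c))) => //.
  move=> x; apply: continuous_comp; last exact: cF.
  by apply: cvgD; [exact: cvg_id|exact: cvg_cst].
move=> x /andP[ax _].
have Gx : has_deriv G (x + c) (F (x + c)).
  apply: dG; apply: (@lt_le_trans _ _ (a + c)); first by rewrite ltrBlDr ltrDl.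
  by rewrite lerD2r.
exact: has_deriv_shift Gx.
Qed.

Lemma itg_gt0_point a b F y : continuous F ->
  (forall x, a <= x <= b -> 0 <= F x) -> a < b -> a <= y <= b -> 0 < F y ->
  0 < itg a b F.
Proof.
move=> cF F0 ab /andP[ay yb] Fy.
have e0 : 0 < F y / 2 by rewrite divr_gt0.
have /cvgrPdist_lt/(_ _ e0)/nbhs_ballP[d /= d0 yd] := cF y.
have near z : `|z - y| < d -> F y / 2 <= F z.
  move=> zy; have := yd z; rewrite /ball/= distrC => /(_ zy).
  rewrite ltr_norml => /andP[_]; rewrite ltrBlDr; lra.
(* Clipping to [[a, b]] leaves positive length even when [y] is an end point, because [a < b]. *)
pose u := Num.max a (y - d / 2); pose v := Num.min b (y + d / 2).
have uy : a <= u <= y.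
  by rewrite /u le_max lexx/= ge_max ay/= lerBlDr lerDl divr_ge0// ltW.
have yv : y <= v <= b.
  by rewrite /v ge_min lexx/= le_min yb/= andbT lerDl divr_ge0// ltW.
have uv : u < v.
  rewrite /u /v lt_min !gt_max ab/=; move: d0; lra.
case/andP: uy => au uy; case/andP: yv => yv vb.
rewrite (@itg_chasles a u b)// ?au//; last by rewrite (le_trans uy)// (le_trans yv).
rewrite (@itg_chasles u v b)// ?vb ?(ltW uv)//.
apply: (@lt_le_trans _ _ (F y / 2 * (v - u))).
  by rewrite mulr_gt0// subr_gt0.
rewrite -itg_cst; last exact: ltW.
rewrite -[leLHS]add0r; apply: lerD.
  apply: itg_ge0 => x /andP[ax xu]; apply: F0; rewrite ax/=.
  by rewrite (le_trans xu)// (le_trans uy).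
rewrite -[leLHS]addr0; apply: lerD.
  apply: le_itg => //; first by move=> ?; exact: cvg_cst.
  move=> x /andP[ux xv]; apply: near; rewrite ltr_norml.
  move: ux xv; rewrite /u /v ge_max le_min; move: d0; lra.
apply: itg_ge0 => x /andP[vx xb]; apply: F0; rewrite xb andbT.
by rewrite (le_trans _ vx)// (le_trans ay).
Qed.

Lemma itg_eq0P a b F : continuous F -> a < b ->
  (forall x, a <= x <= b -> 0 <= F x) -> itg a b F = 0 ->
  forall x, a <= x <= b -> F x = 0.
Proof.
move=> cF ab F0 I0 x xab; apply/eqP; rewrite eq_le F0// andbT leNgt.
apply/negP => Fx; suff: 0 < itg a b F by rewrite I0 ltxx.
exact: itg_gt0_point Fx.
Qed.

(** Tube lemma: by compactness of [[a, b]], neighbourhoods of the points [(x0, y)] contain a common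
    strip around [x0]. *)
Lemma near_itv (X : topologicalType) (x0 : X) a b (P : X -> R -> Prop) :
  (forall y, a <= y <= b -> \forall p \near (x0, y), P p.1 p.2) ->
  \forall x \near x0, forall y, a <= y <= b -> P x y.
Proof.
move=> H.
have /compact_near_coveringP /(_ X (nbhs x0) P _) := @segment_compact R a b.
have H' y : `[a, b]%classic y -> \forall x' \near y & i \near nbhs x0, P i x'.
  rewrite /= in_itv/= => /H [[A B] /= [A1 B1] AB].
  exists (B, A) => //= -[u v] /= [Bu Av].
  exact: (AB (v, u)).
move=> /(_ H'); apply: filterS => x xP y yab.
by apply: xP; rewrite /= in_itv.
Qed.

Lemma near_unif_itv (X : topologicalType) (x0 : X) a b (F : X -> R -> R) (e : R) :
  0 < e -> continuous (F x0) ->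
  (forall y, a <= y <= b -> {for (x0, y), continuous (fun p => F p.1 p.2)}) ->
  \forall z \near x0, forall y, a <= y <= b -> `|F x0 y - F z y| <= e.
Proof.
move=> e0 cF0 jc; apply: near_itv => y yab.
have e2 : 0 < e / 2 by rewrite divr_gt0.
have jcy := jc y yab.
have /cvgrPdist_lt/(_ _ e2) H1 := jcy.
have H2 : \forall p \near (x0, y), `|F x0 y - F x0 p.2| < e / 2.
  have /cvgrPdist_lt/(_ _ e2) := cF0 y.
  by move=> H; apply: (@cvg_snd _ _ (nbhs x0) (nbhs y) _ _ H).
move: H1 H2; apply: filterS2 => p /= h1 h2.
rewrite [leRHS]splitr (le_trans (ler_distD (F x0 y) _ _))// lerD// ltW//.
by rewrite distrC.
Qed.

Lemma itg_continuous (X : topologicalType) (x0 : X) a b (F : X -> R -> R) :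
  a <= b ->
  (\forall x \near x0, continuous (F x)) ->
  (forall y, a <= y <= b -> {for (x0, y), continuous (fun p => F p.1 p.2)}) ->
  (fun z => itg a b (F z)) @ x0 --> itg a b (F x0).
Proof.
move=> ab cF jc; apply/cvgrPdist_le => e e0.
have cF0 := nbhs_singleton cF.
(* The added 1 keeps the denominator positive when [a = b]. *)
have ba0 : 0 < b - a + 1 by rewrite ltr_wpDl// subr_ge0.
have e1 : 0 < e / (b - a + 1) by rewrite divr_gt0.
have H : \forall x \near x0, forall y, a <= y <= b ->
    `|F x0 y - F x y| <= e / (b - a + 1).
  exact: near_unif_itv.
near=> x.
have cFx : continuous (F x) by near: x.
rewrite -itgB//.
apply: (@le_trans _ _ (e / (b - a + 1) * (b - a))).
  apply: normr_itg_le => //.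
    by move=> y; apply: cvgB; [exact: cF0|exact: cFx].
  by near: x.
rewrite -mulrA ler_piMr//; first exact: ltW.
by rewrite mulrC ler_pdivrMr// mul1r lerDl.
Unshelve. all: by end_near. Qed.

Lemma near_dist (t0 : R) (P : R -> Prop) : (\forall t \near t0, P t) ->
  exists2 d, 0 < d & forall t, `|t - t0| < d -> P t.
Proof.
move=> /nbhs_ballP[d /= d0 Hd]; exists d => // t td; apply: Hd.
by rewrite /ball/= distrC.
Qed.

(** * Division-free derivatives, differentiation under the integral, and a chain rule *)

Lemma has_deriv_eps (G : R -> R) (t0 l : R) :
  (forall e, 0 < e -> \forall t \near t0,
     `|G t - G t0 - l * (t - t0)| <= e * `|t - t0|) ->
  has_deriv G t0 l.
Proof.
move=> H.
have C : (fun h => h^-1 *: (G (h *: 1 + t0) - G t0)) @ 0^' --> l.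
  apply/cvgrPdist_le => e e0.
  have /nbhs_ballP[d /= d0 Hd] := H e e0.
  apply/nbhs_ballP; exists d => // h; rewrite /ball/= sub0r normrN => hd h0.
  have := Hd (h + t0); rewrite /ball/= opprD addrCA subrr addr0 normrN addrK.
  move=> /(_ hd) h1; rewrite /GRing.scale/= mulr1.
  rewrite -(ler_pM2r (_ : 0 < `|h|)) ?normr_gt0//.
  apply: le_trans h1.
  by rewrite -normrM mulrBl mulrAC mulVf// mul1r distrC.
split; first by apply/cvg_ex; exists l.
by apply/cvg_lim => //.
Qed.

(** Distances to [x0] replace the order of the two points, so that increments to the left and to the
    right are treated alike. *)
Lemma MVT_dist (F dF : R -> R) (x0 x : R) :
  (forall c, `|c - x0| <= `|x - x0| -> has_deriv F c (dF c)) ->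
  exists2 c, `|c - x0| <= `|x - x0| & F x - F x0 = dF c * (x - x0).
Proof.
move=> dFc; have cFc c : `|c - x0| <= `|x - x0| -> {for c, continuous F}.
  move=> /dFc[dc _].
  by apply: differentiable_continuous; apply/derivable1_diffP.
have [xx0|xx0|->] := ltgtP x x0; last first.
- by exists x0; rewrite ?subrr ?mulr0.
- have le c : x0 <= c <= x -> `|c - x0| <= `|x - x0|.
    by move=> /andP[h1 h2]; rewrite !ger0_norm ?subr_ge0// ?lerD2r// ltW.
  have d1 c : c \in `]x0, x[ -> is_derive c 1 F (dF c).
    by rewrite in_itv/= => /andP[/ltW h1 /ltW h2]; apply: dFc; rewrite le// h1.
  have c1 : {within `[x0, x], continuous F}.
    apply: continuous_in_subspaceT => c; rewrite inE/= in_itv/= => h.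
    exact/cFc/le.
  have [c] := MVT xx0 d1 c1.
  rewrite in_itv/= => /andP[/ltW h1 /ltW h2] h3; exists c => //.
  by rewrite le// h1.
- have le c : x <= c <= x0 -> `|c - x0| <= `|x - x0|.
    move=> /andP[h1 h2]; rewrite !ler0_norm ?subr_le0// ?(ltW xx0)//.
    by rewrite lerN2 lerD2r.
  have d1 c : c \in `]x, x0[ -> is_derive c 1 F (dF c).
    by rewrite in_itv/= => /andP[/ltW h1 /ltW h2]; apply: dFc; rewrite le// h1.
  have c1 : {within `[x, x0], continuous F}.
    apply: continuous_in_subspaceT => c; rewrite inE/= in_itv/= => h.
    exact/cFc/le.
  have [c] := MVT xx0 d1 c1.
  rewrite in_itv/= => /andP[/ltW h1 /ltW h2] h3; exists c.
    by rewrite le// h1.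
  by rewrite -opprB h3 -mulrN opprB.
Qed.

(** By the mean value theorem the remainder of the integrand is an increment of [dF] times [t - t0],
    and that increment is small uniformly on the compact interval. *)
Lemma itg_has_deriv (t0 a b : R) (F dF : R -> R -> R) : a <= b ->
  (\forall t \near t0, continuous (F t) /\
     forall y, a <= y <= b -> has_deriv (F ^~ y) t (dF t y)) ->
  continuous (dF t0) ->
  (forall y, a <= y <= b -> {for (t0, y), continuous (fun p => dF p.1 p.2)}) ->
  has_deriv (fun t => itg a b (F t)) t0 (itg a b (dF t0)).
Proof.
move=> ab nF cdF jc; apply: has_deriv_eps => e e0.
have ba0 : 0 < b - a + 1 by rewrite ltr_wpDl// subr_ge0.
have e1 : 0 < e / (b - a + 1) by rewrite divr_gt0.
have H : \forall t \near t0, forall y, a <= y <= b ->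
    `|dF t0 y - dF t y| <= e / (b - a + 1).
  exact: near_unif_itv.
have [d /= d0 Hd] : exists2 d : R, 0 < d & forall t, `|t - t0| < d ->
   [/\ continuous (F t), (forall y, a <= y <= b -> has_deriv (F ^~ y) t (dF t y))
     & forall y, a <= y <= b -> `|dF t0 y - dF t y| <= e / (b - a + 1)].
  have [d d0 Hd] := near_dist _ _ (filterI nF H).
  by exists d => // t /Hd[[? ?] ?].
apply/nbhs_ballP; exists d => // t; rewrite /ball/= distrC => td.
have [cFt dFt nt] := Hd t td.
have [|cF0 dF0 _] := Hd t0; first by rewrite subrr normr0.
have -> : itg a b (dF t0) * (t - t0) = itg a b (fun y => dF t0 y * (t - t0)).
  rewrite mulrC -itgZ//; apply: eq_itg => y _; exact: mulrC.
rewrite -itgB// -itgB//.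
- apply: (@le_trans _ _ (e / (b - a + 1) * `|t - t0| * (b - a))); last first.
    rewrite mulrAC ler_wpM2r// -mulrA ler_piMr//; first exact: ltW.
    by rewrite mulrC ler_pdivrMr// mul1r lerDl.
  apply: normr_itg_le => //.
    move=> y; apply: cvgB; first by apply: cvgB; [exact: cFt|exact: cF0].
    by apply: cvgM; [exact: cdF|exact: cvg_cst].
  move=> y yab.
  have [c cin ->] : exists2 c, `|c - t0| < d & F t y - F t0 y = dF c y * (t - t0).
    have [c|c h1 h2] := @MVT_dist (F ^~ y) (dF ^~ y) t0 t.
      by move=> h; have [|_ + _] := Hd c; [exact: le_lt_trans h td|apply].
    by exists c => //; exact: le_lt_trans h1 td.
  rewrite -mulrBl normrM ler_wpM2r// distrC.
  by have [_ _] := Hd c cin; apply.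
- by move=> y; apply: cvgB; [exact: cFt|exact: cF0].
- by move=> y; apply: cvgM; [exact: cdF|exact: cvg_cst].
Qed.

Lemma has_deriv_expansion (G : R -> R) (t0 l e : R) : has_deriv G t0 l ->
  0 < e -> \forall t \near t0, `|G t - G t0 - l * (t - t0)| <= e * `|t - t0|.
Proof.
move=> [dG Gl] e0.
have C : (fun h => h^-1 *: (G (h *: 1 + t0) - G t0)) @ 0^' --> l.
  by rewrite -Gl; exact: dG.
move: C => /cvgrPdist_le/(_ e e0)/nbhs_ballP[d /= d0 Hd].
apply/nbhs_ballP; exists d => // t; rewrite /ball/= distrC => td.
have [->|tt0] := eqVneq t t0; first by rewrite !subrr mulr0 subrr normr0 mulr0.
have /= := Hd (t - t0); rewrite /ball/= sub0r normrN => /(_ td).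
rewrite subr_eq0 => /(_ tt0); rewrite /GRing.scale/= mulr1 subrK => h.
rewrite -(divfK (_ : t - t0 != 0) (G t - G t0)) ?subr_eq0// -mulrBl normrM.
by rewrite ler_wpM2r// distrC mulrC.
Qed.

Lemma near_dist2 (x0 t0 : R) (P : R * R -> Prop) :
  (\forall p \near (x0, t0), P p) ->
  exists2 d, 0 < d & forall x t, `|x - x0| < d -> `|t - t0| < d -> P (x, t).
Proof.
move=> /nbhs_ballP[d /= d0 Hd]; exists d => // x t xd td; apply: (Hd (x, t)).
by split; rewrite /ball/= distrC.
Qed.

(** The hypotheses are asymmetric on purpose. The derivative in the first argument exists near the
    point and is continuous at it, so the mean value theorem handles the increment of [a] at the
    perturbed time; the second argument then contributes a derivative at the point alone. *)
Lemma has_deriv_chain2 (F dF : R -> R -> R) (a : R -> R) (t0 a' d : R) :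
  has_deriv a t0 a' -> has_deriv (F (a t0)) t0 d ->
  (\forall p \near (a t0, t0),
     has_deriv (F ^~ p.2) p.1 (dF p.1 p.2)) ->
  {for (a t0, t0), continuous (fun p => dF p.1 p.2)} ->
  has_deriv (fun s => F (a s) s) t0 (dF (a t0) t0 * a' + d).
Proof.
move=> da dF2 dF1 jc; apply: has_deriv_eps => e e0.
set D := dF (a t0) t0.
(* Error budget in units of [h |t - t0|]: [|a'| + 1] for the oscillation of [dF] times the increment
   of [a], [|D|] for the remainder of [a], and 1 for the second argument. The increment bound for
   [a] uses [h <= 1]. *)
pose C := `|a'| + `|D| + 2.
have C0 : 0 < C by rewrite ltr_wpDl// addr_ge0.
pose h := Num.min 1 (e / C).
have h0 : 0 < h by rewrite lt_min ltr01 divr_gt0.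
have h1 : h <= 1 by rewrite ge_min lexx.
have hC : h * C <= e by rewrite -ler_pdivlMr// ge_min lexx orbT.
have /cvgrPdist_le/(_ _ h0) jc1 := jc.
have [r r0 Hr] := near_dist2 _ _ _ (filterI dF1 jc1).
have ca : {for t0, continuous a}.
  by apply: differentiable_continuous; apply/derivable1_diffP; case: da.
have /cvgrPdist_lt/(_ _ r0) n1 := ca.
have n2 := has_deriv_expansion _ _ _ _ da h0.
have n3 := has_deriv_expansion _ _ _ _ dF2 h0.
have n4 : \forall t \near t0, `|t0 - t| < r.
  by apply/nbhs_ballP; exists r => // t.
near=> t.
have m1 : `|a t0 - a t| < r by near: t; exact: n1.
have m2 : `|a t - a t0 - a' * (t - t0)| <= h * `|t - t0| by near: t; exact: n2.
have m3 : `|F (a t0) t - F (a t0) t0 - d * (t - t0)| <= h * `|t - t0|.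
  by near: t; exact: n3.
have m4 : `|t0 - t| < r by near: t; exact: n4.
have [c cl ->] : exists2 c, `|dF c t - D| <= h &
    F (a t) t - F (a t0) t0 = dF c t * (a t - a t0) + (F (a t0) t - F (a t0) t0).
  rewrite distrC in m1; rewrite distrC in m4.
  have [c|c c1 c2] := @MVT_dist (F ^~ t) (dF ^~ t) (a t0) (a t).
    by move=> cl; have [] := Hr c t (le_lt_trans cl m1) m4.
  exists c; last by rewrite -c2 addrA subrK.
  by rewrite distrC; have [] := Hr c t (le_lt_trans c1 m1) m4.
have -> : dF c t * (a t - a t0) + (F (a t0) t - F (a t0) t0) -
   (D * a' + d) * (t - t0) =
   (dF c t - D) * (a t - a t0) + D * (a t - a t0 - a' * (t - t0)) +
   (F (a t0) t - F (a t0) t0 - d * (t - t0)) by ring.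
have at_le : `|a t - a t0| <= (`|a'| + 1) * `|t - t0|.
  rewrite -[X in `|X|](subrK (a' * (t - t0))) (le_trans (ler_normD _ _))//.
  rewrite normrM mulrDl [leRHS]addrC lerD2r (le_trans m2)//.
  by rewrite ler_wpM2r.
apply: (le_trans (ler_normD _ _)).
apply: (@le_trans _ _ (h * C * `|t - t0|)); last by rewrite ler_wpM2r.
have -> : h * C * `|t - t0| = (h * ((`|a'| + 1) * `|t - t0|) +
  `|D| * (h * `|t - t0|)) + h * `|t - t0| by rewrite /C; ring.
apply: lerD => //; apply: (le_trans (ler_normD _ _)).
by rewrite !normrM lerD// ?ler_wpM2l// ler_pM.
Unshelve. all: by end_near. Qed.

(** * Periodic integrands *)

Lemma periodic_int (F : R -> R) T (k : int) x : (forall y, F (y + T) = F y) ->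
  F (x + k%:~R * T) = F x.
Proof.
move=> FT.
have P (n : nat) y : F (y + n%:R * T) = F y.
  elim: n y => [|n IH] y; first by rewrite mul0r addr0.
  by rewrite -natr1 mulrDl mul1r addrA FT.
case: k => n; first exact: P.
by rewrite NegzE mulrNz mulNr -[in RHS](subrK (n.+1%:R * T) x) P.
Qed.

(** Whole periods bring [x] to within one period below [y]; the piece then lost at the left end is a
    translate of the piece gained at the right end. *)
Lemma itg_periodic (F : R -> R) T x y : 0 < T -> continuous F ->
  (forall y, F (y + T) = F y) -> itg x (x + T) F = itg y (y + T) F.
Proof.
move=> T0 cF FT.
wlog xy : x y / x <= y.
  by move=> H; case/orP: (le_total x y) => h; [|symmetry]; apply: H.
have step z n : itg z (z + T) F = itg (z + n%:R * T) (z + n%:R * T + T) F.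
  elim: n => [|n ->]; first by rewrite mul0r addr0.
  rewrite -natr1 mulrDl mul1r addrA -itg_shift ?lerDl ?ltW//.
  by apply: eq_itg => w _; rewrite FT.
pose n := Num.truncn ((y - x) / T).
have n1 : n%:R * T <= y - x < n%:R * T + T.
  have := truncn_itv (_ : 0 <= (y - x) / T).
  rewrite divr_ge0 ?subr_ge0//; last exact: ltW.
  by move=> /(_ isT); rewrite -/n ler_pdivlMr// ltr_pdivrMr// -natr1 mulrDl mul1r.
rewrite (step x n); set z := x + n%:R * T.
have [zy yz] : z <= y /\ y <= z + T by move: n1; rewrite /z; split; lra.
rewrite (@itg_chasles z y) ?zy//.
rewrite (@itg_chasles y (z + T) (y + T)) ?yz ?lerD2r//.
rewrite addrC; congr (_ + _).
rewrite -(@itg_shift z y T)//; apply: eq_itg => w _.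
by rewrite FT.
Qed.

End IntervalIntegral.

(** * Growth and bootstrap arguments *)

Section Growth.
Context {R : realType}.
Implicit Types (G r : R -> R) (a b c k A B : R).

(** Continuity is asked of the even reflection of [G], because [a] may be 0 and nothing is known of
    [G] at negative times. *)
Lemma linear_growth G k a b : 0 <= a <= b ->
  (forall t, a <= t <= b -> continuous_at t (fun s : R => G `|s|)) ->
  (forall t, a < t < b -> exists2 d, has_deriv G t d & k <= d) ->
  k * (b - a) <= G b - G a.
Proof.
move=> /andP[a0 ab] cG dG.
have [<-|/eqP anb] := eqVneq a b; first by rewrite !subrr mulr0.
have {anb}ab : a < b by rewrite lt_neqAle ab andbT; apply/eqP.
have near_norm t : a < t -> \forall s \near t, G s = G `|s|.
  move=> at_; have := lt_nbhsr at_; apply: filterS => s sa.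
  by rewrite ger0_norm// (le_trans a0)// ltW.
have d1 t : t \in `]a, b[ -> is_derive t (1 : R) (fun s : R => G `|s|) (G^`()%classic t).
  rewrite in_itv/= => tab; have [d dd _] := dG t tab.
  have [_ ->] := has_deriv_derive1 _ _ _ dd.
  by apply: has_deriv_near dd; apply: near_norm; case/andP: tab.
have c1 : {within `[a, b], continuous (fun s : R => G `|s|)}.
  by apply: continuous_in_subspaceT => t; rewrite inE/= in_itv/=; exact: cG.
have [t tab] := MVT ab d1 c1.
rewrite (ger0_norm a0) (ger0_norm (le_trans a0 (ltW ab))) => ->.
rewrite ler_wpM2r ?subr_ge0 ?(ltW ab)//.
move: tab; rewrite in_itv/= => tab; have [d dd kd] := dG t tab.
by have [_ ->] := has_deriv_derive1 _ _ _ dd.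
Qed.

(** Multiplication by [expR (- c * t)] makes the function nondecreasing. Neither [G] nor [c] has a
    prescribed sign, so that applying this to [- G] with a negative rate gives decay. *)
Lemma exponential_growth G c a b : 0 <= a <= b ->
  (forall t : R, 0 <= t -> continuous_at t (fun s : R => G `|s|)) ->
  (forall t : R, 0 < t -> exists2 d, has_deriv G t d & c * G t <= d) ->
  G a * expR (c * (b - a)) <= G b.
Proof.
move=> ab cG dG; have /andP[a0 ab'] := ab.
pose H t := G t * expR (- c * t).
have : 0 * (b - a) <= H b - H a.
  apply: linear_growth => // t.
    move=> /andP[at_ _]; rewrite /H.
    apply: continuous_atM; first by apply: cG; exact: le_trans at_.
    by apply: (continuous_at_comp (fun s : R => - c * `|s|) (@expR R));
      [continuity|exact: continuous_expR].
  move=> /andP[at_ _]; have [d dd cd] := dG t (le_lt_trans a0 at_).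
  have de : has_deriv (fun s => expR (- c * s)) t (expR (- c * t) * (- c * 1)).
    by apply: (has_deriv_comp (@expR R));
      [apply: has_derivZ; exact: has_deriv_id|exact: is_derive_expR].
  exists (d * expR (- c * t) + G t * (expR (- c * t) * (- c * 1))).
    exact: has_derivM.
  rewrite (_ : _ + _ = (d - c * G t) * expR (- c * t)); last by ring.
  by rewrite mulr_ge0 ?expR_ge0// subr_ge0.
rewrite mul0r subr_ge0 /H => H1.
have := ler_wpM2r (expR_ge0 (c * b)) H1.
rewrite -!mulrA -!expRD !mulNr addNr expR0 mulr1.
by rewrite mulrBr addrC.
Qed.

(** Let [t] be the infimum of the times at which [r] is at most the midpoint of [B] and [A]. Before
    [t] the function exceeds [B], so [step] gives [A <= r] there, and by continuity also at [t].
    Then [r] stays above the midpoint for a while after [t], which contradicts the infimum. *)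
Lemma continuity_bootstrap r A B : B < A -> A <= r 0 ->
  (forall t, continuous_at t (fun s : R => r `|s|)) ->
  (forall t, 0 <= t -> (forall s, 0 <= s <= t -> B < r s) -> A <= r t) ->
  forall t, 0 <= t -> A <= r t.
Proof.
move=> BA r0 cr step t1 t10; rewrite leNgt; apply/negP => rt1.
pose mid := (A + B) / 2.
have midA : mid < A by rewrite /mid; lra.
have midB : B < mid by rewrite /mid; lra.
pose Z := [set t | 0 <= t /\ r t <= mid].
have Z0 : Z !=set0.
  apply/set0P/negP => /eqP Z0; have : A <= r t1.
    apply: step => // s /andP[s0 _]; rewrite (lt_trans midB)// ltNge.
    by apply/negP => rs; have : Z s by []; rewrite Z0.
  by rewrite leNgt rt1.
have lbZ : lbound Z 0 by move=> t [].
have hZ : has_inf Z by split => //; exists 0.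
pose t := inf Z.
have t0 : 0 <= t by exact: lb_le_inf.
have below s : 0 <= s -> s < t -> mid < r s.
  move=> s0 st; rewrite ltNge; apply/negP => rs.
  have : t <= s by apply: ge_inf => //; exists 0.
  by rewrite leNgt st.
have belowA s : 0 <= s -> s < t -> A <= r s.
  move=> s0 st; apply: step => // u /andP[u0 us]; apply: lt_trans midB _.
  by apply: below => //; exact: le_lt_trans st.
have rt : A <= r t.
  have [t_eq0|t_neq0] := eqVneq t 0; first by rewrite t_eq0.
  have tp : 0 < t by rewrite lt_neqAle eq_sym t_neq0.
  rewrite leNgt; apply/negP => rtA.
  have e0 : 0 < A - r t by rewrite subr_gt0.
  have /cvgrPdist_lt/(_ _ e0)/near_dist[d d0 Hd] := cr t.
  pose s := Num.max 0 (t - d / 2).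
  have s0 : 0 <= s by rewrite le_max lexx.
  have st : s < t by rewrite gt_max tp/=; lra.
  have sd : t - d / 2 <= s by rewrite le_max lexx orbT.
  have := Hd s; rewrite (ger0_norm s0) (ger0_norm t0).
  move=> /(_ ltac:(rewrite ltr_norml; lra)); rewrite ltr_norml => /andP[+ _].
  by have := belowA s s0 st; lra.
have e0 : 0 < r t - mid by lra.
have /cvgrPdist_lt/(_ _ e0)/near_dist[d d0 Hd] := cr t.
have [s [s0 rs] sd] := inf_adherent d0 hZ.
have ts : t <= s by apply: ge_inf => //; exists 0.
have := Hd s; rewrite (ger0_norm s0) (ger0_norm t0).
move=> /(_ ltac:(rewrite ltr_norml -/t in sd *; lra)); rewrite ltr_norml => /andP[_].
by move: rs; lra.
Qed.

(** The shape of a net flux through the two ends of an arc: [u] and [v] are densities at the ends,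
    [x] and [y] the speeds of the ends relative to the flow. *)
Lemma subr_mulr_ge0 (x y u v : R) : 0 <= x -> y <= 0 -> 0 <= u -> 0 <= v ->
  0 <= x * u - y * v.
Proof.
by move=> x0 y0 u0 v0; rewrite subr_ge0 (le_trans (mulr_le0_ge0 y0 v0))// mulr_ge0.
Qed.

End Growth.

(** * Integrals over strips *)

Section PlaneIntegral.
Context {R : realType}.
Local Notation leb := (@lebesgue_measure R).
Local Notation leb2 := (leb \x leb)%E.
Local Notation mR := (measurableTypeR R).

(** The link between the product topology and the product sigma-algebra: an open set is the union of
    the countably many rational boxes that it contains. *)
Lemma open_measurable2 (U : set (R * R)) : open U ->
  measurable (U : set (mR * mR)).
Proof.
move=> oU.
pose box (q : rat * rat * (rat * rat)) : set (mR * mR) :=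
  `]ratr q.1.1, ratr q.1.2[%classic `*` `]ratr q.2.1, ratr q.2.2[%classic.
have -> : U = \bigcup_q (if `[< box q `<=` U >] then box q else set0).
  apply/seteqP; split => [[x y] Uxy|p [q _]]; last first.
    by case: ifPn => // /asboolP; apply.
  have [d d0 Hd] := near_dist2 _ _ _ (open_nbhs_nbhs (conj oU Uxy)).
  have [a1] := @rat_in_itvoo R (x - d) x ltac:(by rewrite ltrBlDr ltrDl).
  rewrite in_itv/= => /andP[a1l a1r].
  have [a2] := @rat_in_itvoo R x (x + d) ltac:(by rewrite ltrDl).
  rewrite in_itv/= => /andP[a2l a2r].
  have [b1] := @rat_in_itvoo R (y - d) y ltac:(by rewrite ltrBlDr ltrDl).
  rewrite in_itv/= => /andP[b1l b1r].
  have [b2] := @rat_in_itvoo R y (y + d) ltac:(by rewrite ltrDl).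
  rewrite in_itv/= => /andP[b2l b2r].
  exists ((a1, a2), (b1, b2)) => //.
  rewrite asboolT; first by rewrite /box/=; split; rewrite /= in_itv/=; apply/andP.
  move=> [u v]; rewrite /box/= !in_itv/= => -[/andP[u1 u2] /andP[v1 v2]].
  by apply: Hd; rewrite ltr_norml; apply/andP; split; lra.
apply: countable_bigcupT_measurable => [|q]; first exact: countableP.
by case: ifP => // _; apply: measurableX; exact: measurable_itv.
Qed.

Lemma continuous_measurable_fun2 (F : R * R -> R) : continuous F ->
  measurable_fun setT (F : mR * mR -> mR).
Proof.
move=> /continuousP cF; apply: (measurability _ (RGenOpens.measurableE R)).
move=> _ [_ [a [b ->] <-]]; rewrite setTI; apply: open_measurable2.
exact/cF/interval_open.
Qed.

Lemma Rintegral_setX (A : set R) (h : R * R -> R) : measurable (A : set mR) ->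
  leb2.-integrable (A `*` setT) (EFin \o h) ->
  \int[leb2]_(p in A `*` setT) h p =
    fine (\int[leb]_(y in setT) \int[leb]_(x in A) (h (x, y))%:E)%E /\
  \int[leb2]_(p in A `*` setT) h p =
    fine (\int[leb]_(x in A) \int[leb]_(y in setT) (h (x, y))%:E)%E.
Proof.
move=> mA hi.
have mAT : measurable (A `*` setT : set (mR * mR)) by exact: measurableX.
have hi' : leb2.-integrable setT ((EFin \o h) \_ (A `*` setT)).
  exact: (@integrable_mkcond _ _ _ leb2 _ (EFin \o h) mAT).1.
rewrite /Rintegral integral_mkcond; split.
  rewrite -(@integral21_prod_meas1 _ _ _ _ _ leb leb _ hi') /fubini_G.
  congr fine; apply: eq_integral => y _; rewrite [RHS]integral_mkcond.
  apply: eq_integral => x _; rewrite /patch.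
  by have [xA|xA] := boolP (x \in A); [rewrite mem_set//; split => //; exact/set_mem
    |rewrite memNset// => -[xA' _]; move: xA; rewrite mem_set].
rewrite -(@integral12_prod_meas1 _ _ _ _ _ leb leb _ hi') /fubini_F.
congr fine; rewrite [RHS]integral_mkcond; apply: eq_integral => x _.
rewrite [RHS]/patch; have [xA|xA] := boolP (x \in A).
  apply: eq_integral => y _; rewrite /patch mem_set//; split => //; exact/set_mem.
apply: integral0_eq => y _; rewrite /patch memNset// => -[xA' _].
by move: xA; rewrite mem_set.
Qed.

(** Vanishing for large [|y|] reduces the strip to a compact rectangle, on which continuity gives
    integrability. The flag [b0] covers both the torus, closed on the left, and the open arcs. *)
Lemma Rintegral_setX_itg (M a b : R) (b0 : bool) (F : R * R -> R) :
  continuous F -> (forall x y, M <= `|y| -> F (x, y) = 0) -> a < b ->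
  \int[leb2]_(p in [set` Interval (BSide b0 a) (BLeft b)] `*` setT) F p =
  itg (- M) M (fun y => itg a b (fun x => F (x, y))).
Proof.
move=> cF F0 ab; set A := [set` _].
have mA : measurable (A : set mR) by exact: measurable_itv.
have mK : measurable (`[a, b]%classic `*` `[- M, M]%classic : set (mR * mR)).
  by apply: measurableX; exact: measurable_itv.
have iK : leb2.-integrable (`[a, b] `*` `[- M, M]) (EFin \o F).
  apply: measurable_bounded_integrable => //.
  - have mab : measurable (`[a, b]%classic : set mR) by exact: measurable_itv.
    have mMM : measurable (`[- M, M]%classic : set mR) by exact: measurable_itv.
    rewrite [X in (X < _)%E](product_measure1E leb leb mab mMM).
    by apply: lte_mul_pinfty => //; rewrite ?ge0_fin_numE//;
      apply: compact_finite_measure; exact: segment_compact.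
  - by apply: measurable_funTS; exact: continuous_measurable_fun2.
  - have cK := compact_setX (@segment_compact R a b) (@segment_compact R (- M) M).
    have /compact_bounded[B [_ mrt]] :=
      continuous_compact (continuous_subspaceT cF) cK.
    by exists B; split; rewrite ?num_real// => ? ? ? ?; exact: mrt.
have iA : leb2.-integrable (A `*` setT) (EFin \o F).
  have : leb2.-integrable (`[a, b] `*` setT) (EFin \o F).
    have mabT : measurable (`[a, b]%classic `*` setT : set (mR * mR)).
      by apply: measurableX => //; exact: measurable_itv.
    apply/(integrable_mkcond _ mabT).
    move/(integrable_mkcond _ mK) : iK; congr (_.-integrable _ _).
    apply/funext => -[x y]; rewrite /patch.
    have [xab|xab] := boolP (x \in `[a, b]%classic); last first.
      by rewrite !memNset// => -[xin _]; move: xab; rewrite mem_set.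
    have [yM|yM] := boolP (y \in `[- M, M]%classic).
      by rewrite !mem_set//; split => //=; exact/set_mem.
    rewrite memNset; last by move=> [_ yin]; move: yM; rewrite mem_set.
    rewrite mem_set/=; last by split => //; exact/set_mem.
    rewrite F0//; move: yM; rewrite notin_setE/= in_itv/= -ler_norml => /negP.
    by rewrite -ltNge => /ltW.
  apply: integrableS => //.
  - by apply: measurableX => //; exact: measurable_itv.
  - exact: measurableX.
  move=> [x y] [/= xA _]; split => //=; apply: subset_itv xA.
    by case: (b0); rewrite bnd_simp.
  by rewrite bnd_simp.
rewrite (Rintegral_setX _ _ mA iA).1.
have inner y : (\int[leb]_(x in A) (F (x, y))%:E = (itg a b (fun x => F (x, y)))%:E)%E.
  have cy : continuous (fun x => F (x, y)).
    by move=> x; apply: (continuous_at_comp (fun x => (x, y)) F); continuity.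
  have my : measurable_fun `]a, b[ (fun x => (F (x, y))%:E).
    apply/measurable_EFinP/measurable_funTS; exact: continuous_measurable_fun.
  rewrite /itg /Rintegral /A integral_itv_bndoo// -(integral_itv_bndoo true false)//.
  rewrite fineK//; apply: integrable_fin_num => //; exact: itg_integrable.
under eq_integral do rewrite inner.
congr fine; rewrite [RHS]integral_mkcond; apply: eq_integral => y _.
rewrite /patch; case: ifPn => // yM; rewrite itg_eqfun0// => x _; apply: F0.
move: yM; rewrite notin_setE/= in_itv/= -ler_norml => /negP.
by rewrite -ltNge => /ltW.
Qed.

(* The inner integral may be infinite on a null set of [x], where [fine] gives [0]. *)
Lemma Rintegral_density (A : set R) (w : R -> R) (h : R * R -> R) :
  measurable (A : set mR) -> continuous w -> (forall x, `|w x| <= 1) ->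
  leb2.-integrable (A `*` setT) (EFin \o h) ->
  leb2.-integrable (A `*` setT) (EFin \o (fun p => w p.1 * h p)) /\
  \int[leb]_(x in A) (w x * \int[leb]_(y in setT) h (x, y)) =
  \int[leb2]_(p in A `*` setT) (w p.1 * h p).
Proof.
move=> mA cw w1 ih.
have mAT : measurable (A `*` setT : set (mR * mR)) by exact: measurableX.
have mh := measurable_int _ ih.
have mw : measurable_fun (A `*` setT) (fun p : mR * mR => w p.1).
  apply: measurable_funTS; apply: measurableT_comp => //.
  exact: continuous_measurable_fun.
have iwh : leb2.-integrable (A `*` setT) (EFin \o (fun p => w p.1 * h p)).
  apply: le_integrable ih => //.
    apply/measurable_EFinP/measurable_funM => //; exact/measurable_EFinP.
  by move=> p _; rewrite lee_fin normrM ler_piMl.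
split=> //; rewrite (Rintegral_setX _ _ mA iwh).2; congr fine.
have mkT (g : R * R -> R) : leb2.-integrable (A `*` setT) (EFin \o g) ->
    leb2.-integrable setT ((EFin \o g) \_ (A `*` setT)).
  exact: (@integrable_mkcond _ _ _ leb2 _ (EFin \o g) mAT).1.
have ih' := mkT _ ih; have iwh' := mkT _ iwh.
have ae := ae_integrable1 ih'.
have pE (g : R * R -> R) x y : A x -> ((EFin \o g) \_ (A `*` setT)) (x, y) = (g (x, y))%:E.
  by move=> Ax; rewrite /patch mem_set.
have mF (g : R * R -> R) : leb2.-integrable setT ((EFin \o g) \_ (A `*` setT)) ->
    measurable_fun A (fun x => \int[leb]_y (g (x, y))%:E)%E.
  move=> ig; apply: (eq_measurable_fun (fubini_F leb ((EFin \o g) \_ (A `*` setT)))).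
    move=> x /set_mem Ax; rewrite /fubini_F; apply: eq_integral => y _; exact: pE.
  apply: measurable_funTS; exact: (measurable_fubini_F ig).
apply: ae_eq_integral => //.
- apply/measurable_EFinP/measurable_funM.
    apply: measurable_funTS; exact: continuous_measurable_fun.
  by apply: measurableT_comp; [exact: fine_measurable|exact: mF].
- exact: (mF (fun p => w p.1 * h p)).
- move: ae; apply: filterS => x ix Ax.
  have {}ix : leb.-integrable setT (fun y => (h (x, y))%:E).
    by move: ix; congr (_.-integrable _ _); apply/funext => y; exact: pE.
  rewrite EFinM fineK; last exact: integrable_fin_num.
  rewrite -integralZl//.
Qed.

End PlaneIntegral.

(** * Transport in a moving frame *)

Section MovingFrame.
Context {R : realType}.

(** The derivatives are explicit arguments, so that the class is closed under [frame_itg] and under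
    squaring with known derivatives. The frequency is a parameter, hence no derivative in
    [omega]. *)
Record C1_theta_t (h h1 h3 : R -> R -> R -> R) : Prop := C1ThetaT {
  C1_cont : forall theta omega t : R, 0 < t ->
    {for (theta, omega, t), continuous (uncurry3 h)};
  C1_cont1 : forall theta omega t : R, 0 < t ->
    {for (theta, omega, t), continuous (uncurry3 h1)};
  C1_cont3 : forall theta omega t : R, 0 < t ->
    {for (theta, omega, t), continuous (uncurry3 h3)};
  C1_deriv1 : forall theta omega t : R, 0 < t ->
    has_deriv (fun s => h s omega t) theta (h1 theta omega t);
  C1_deriv3 : forall theta omega t : R, 0 < t ->
    has_deriv (fun s => h theta omega s) t (h3 theta omega t) }.

Lemma near_gt0 (t : R) : 0 < t -> \forall s \near t, 0 < s.
Proof. by move=> t0; apply: lt_nbhsr. Qed.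

Lemma near_snd {X : topologicalType} (x : X) (t : R) (P : R -> Prop) :
  (\forall s \near t, P s) -> \forall p \near (x, t), P p.2.
Proof. by move=> H; apply: (@cvg_snd _ _ (nbhs x) (nbhs t) _ _ H). Qed.

Lemma near_gt0_snd {X : topologicalType} (x : X) (t : R) : 0 < t ->
  \forall p \near (x, t), 0 < p.2.
Proof. by move=> /near_gt0; exact: near_snd. Qed.

(** The result is again a function of a position, [omega] and [t], so it can be differentiated in
    the centre [x] and in time like the solution itself. *)
Definition frame_itg (c d : R) (W : R -> R) (h : R -> R -> R -> R) (x omega t : R) :=
  itg c d (fun s => W s * h (s + x) omega t).

Variables (c d : R) (W : R -> R).
Hypotheses (cd : c <= d) (cW : continuous W).

Section cont.
Variables (P : R -> Prop) (h : R -> R -> R -> R).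
Hypothesis nP : forall t, P t -> \forall s \near t, P s.
Hypothesis ch : forall theta omega t : R, P t ->
  {for (theta, omega, t), continuous (uncurry3 h)}.

(** The predicate [P] stands for an open set of times: the positive ones for the solution and its
    derivatives, all of them for [even_ext]. *)
Lemma frame_integrand_continuous x omega t : P t ->
  continuous (fun s => W s * h (s + x) omega t).
Proof.
move=> t0 s; apply: continuous_atM; first exact: cW.
by apply: continuous_at_curry3; [exact: ch| continuity..].
Qed.

Lemma frame_itg_continuous x omega t : P t ->
  {for (x, omega, t), continuous (uncurry3 (frame_itg c d W h))}.
Proof.
move=> t0; apply: (@itg_continuous R (R * R * R)%type (x, omega, t) c d
  (fun p s => W s * h (s + p.1.1) p.1.2 p.2)) => //.
  have := near_snd (x, omega) t P (nP _ t0); apply: filterS => p p0.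
  exact: frame_integrand_continuous.
move=> y _; apply: continuous_atM; first by apply: continuous_at_comp; continuity.
by apply: continuous_at_curry3; [exact: ch| continuity..].
Qed.
End cont.

Variables h h1 h3 : R -> R -> R -> R.
Hypothesis Ch : C1_theta_t h h1 h3.

Lemma C1_frame_itg :
  C1_theta_t (frame_itg c d W h) (frame_itg c d W h1) (frame_itg c d W h3).
Proof.
case: Ch => ch ch1 ch3 dh1 dh3.
split => x omega t t0; try exact: (frame_itg_continuous (fun t => 0 < t) _ near_gt0).
- apply: (@itg_has_deriv R x c d (fun x s => W s * h (s + x) omega t)
    (fun x s => W s * h1 (s + x) omega t)) => //.
  + near=> y; split; first exact: (frame_integrand_continuous (fun t => 0 < t)).
    move=> s _; apply: has_derivZ.
    rewrite [X in has_deriv X _ _](_ : _ = fun r => h (r + s) omega t).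
      by apply: (has_deriv_shift (fun r => h r omega t)); rewrite addrC; exact: dh1.
    by apply/funext => r; rewrite addrC.
  + exact: (frame_integrand_continuous (fun t => 0 < t)).
  + move=> y _; apply: continuous_atM; first by apply: continuous_at_comp; continuity.
    by apply: continuous_at_curry3; [exact: ch1| continuity..].
- apply: (@itg_has_deriv R t c d (fun t s => W s * h (s + x) omega t)
    (fun t s => W s * h3 (s + x) omega t)) => //.
  + have := near_gt0 t t0; apply: filterS => y y0.
    split; first exact: (frame_integrand_continuous (fun t => 0 < t)).
    by move=> s _; apply: has_derivZ; exact: dh3.
  + exact: (frame_integrand_continuous (fun t => 0 < t)).
  + move=> y _; apply: continuous_atM; first by apply: continuous_at_comp; continuity.
    by apply: continuous_at_curry3; [exact: ch3| continuity..].
Unshelve. all: by end_near. Qed.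

(** The centre [a] is differentiable at [t] alone, whereas differentiation under the integral needs
    a neighbourhood. So the integral is differentiated in centre and time separately, and [a] enters
    afterwards by the chain rule; the same order is kept when [omega] is integrated too. *)
Lemma frame_itg_derive (a : R -> R) (a' t omega : R) : 0 < t -> has_deriv a t a' ->
  has_deriv (fun s => frame_itg c d W h (a s) omega s) t
   (frame_itg c d W h1 (a t) omega t * a' + frame_itg c d W h3 (a t) omega t).
Proof.
move=> t0 da; case: C1_frame_itg => ch ch1 ch3 dh1 dh3.
apply: (@has_deriv_chain2 R (fun x s => frame_itg c d W h x omega s)
  (fun x s => frame_itg c d W h1 x omega s) a t a' _ da).
- exact: dh3.
- by have := near_gt0_snd (a t) t t0; apply: filterS => p p0; exact: dh1.
- by apply: continuous_at_curry3; [exact: ch1| continuity..].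
Qed.

Variable M : R.
Hypothesis M0 : 0 <= M.

Lemma itg_frame_itg_derive (a : R -> R) (a' t : R) : 0 < t -> has_deriv a t a' ->
  has_deriv
    (fun s => itg (- M) M (fun omega => frame_itg c d W h (a s) omega s)) t
    (itg (- M) M (fun omega => frame_itg c d W h1 (a t) omega t * a'
                               + frame_itg c d W h3 (a t) omega t)).
Proof.
move=> t0 da; case: C1_frame_itg => ch ch1 ch3 dh1 dh3.
have MM : - M <= M by rewrite ge0_cp.
have cs k : (forall theta omega t : R, 0 < t ->
    {for (theta, omega, t), continuous (uncurry3 k)}) ->
    forall x t, 0 < t -> continuous (fun omega => k x omega t).
  by move=> ck x s s0 y; apply: continuous_at_curry3; [exact: ck|continuity..].
have -> : itg (- M) M (fun omega => frame_itg c d W h1 (a t) omega t * a'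
                               + frame_itg c d W h3 (a t) omega t) =
  itg (- M) M (fun omega => frame_itg c d W h1 (a t) omega t) * a' +
  itg (- M) M (fun omega => frame_itg c d W h3 (a t) omega t).
  rewrite itgD; [|by move=> y; apply: continuous_atM; [exact: cs|continuity]|exact: cs].
  congr (_ + _); rewrite mulrC -itgZ; last exact: cs.
  by apply: eq_itg => y _; rewrite mulrC.
apply: (@has_deriv_chain2 R
  (fun x s => itg (- M) M (fun omega => frame_itg c d W h x omega s))
  (fun x s => itg (- M) M (fun omega => frame_itg c d W h1 x omega s)) a t a' _ da).
- apply: (@itg_has_deriv R t (- M) M (fun s omega => frame_itg c d W h (a t) omega s)
    (fun s omega => frame_itg c d W h3 (a t) omega s)) => //.
  + have := near_gt0 t t0; apply: filterS => y y0; split; first exact: cs.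
    by move=> *; exact: dh3.
  + exact: cs.
  + by move=> y _; apply: continuous_at_curry3; [exact: ch3|continuity..].
- have := near_gt0_snd (a t) t t0; apply: filterS => p p0.
  apply: (@itg_has_deriv R p.1 (- M) M (fun x omega => frame_itg c d W h x omega p.2)
    (fun x omega => frame_itg c d W h1 x omega p.2)) => //.
  + near=> y; split; first exact: cs.
    by move=> *; exact: dh1.
  + exact: cs.
  + by move=> y _; apply: continuous_at_curry3; [exact: ch1|continuity..].
- apply: (@itg_continuous R (R * R)%type (a t, t) (- M) M
    (fun p omega => frame_itg c d W h1 p.1 omega p.2)) => //.
  + have := near_gt0_snd (a t) t t0; apply: filterS => p p0; exact: cs.
  + by move=> y _; apply: continuous_at_curry3; [exact: ch1|continuity..].
Unshelve. all: by end_near. Qed.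

(* The hypothesis on [h3] is the equation [h_t + (v h)_theta = r]; the integrand is the
   [s]-derivative of [W (a' - v) h] minus the terms not in divergence form. *)
Lemma frame_itg_transport (v v1 r : R -> R) (W1 : R -> R) (x a' omega t : R) :
  0 < t -> continuous v -> continuous v1 -> continuous r -> continuous W1 ->
  (forall s, has_deriv W s (W1 s)) ->
  (forall theta, has_deriv v theta (v1 theta)) ->
  (forall theta, h3 theta omega t =
     r theta - (v1 theta * h theta omega t + v theta * h1 theta omega t)) ->
  let flux s := W s * (a' - v (s + x)) * h (s + x) omega t in
  frame_itg c d W h1 x omega t * a' + frame_itg c d W h3 x omega t =
  flux d - flux c +
  itg c d (fun s => W1 s * (v (s + x) - a') * h (s + x) omega t + W s * r (s + x)).
Proof.
move=> t0 cv cv1 cr cW1 dW dv eqh flux; case: Ch => ch ch1 ch3 dh1 dh3.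
have sh (F : R -> R) : continuous F -> continuous (fun s : R => F (s + x)).
  by move=> cF s; apply: (continuous_at_comp (fun s => s + x) F); continuity.
have csh k : (forall theta omega t : R, 0 < t ->
    {for (theta, omega, t), continuous (uncurry3 k)}) ->
    continuous (fun s : R => k (s + x) omega t).
  by move=> ck s; apply: continuous_at_curry3; [exact: ck|continuity..].
have cvx := sh _ cv; have cv1x := sh _ cv1; have crx := sh _ cr.
have chx := csh _ ch; have ch1x := csh _ ch1; have ch3x := csh _ ch3.
pose dflux s := W1 s * (a' - v (s + x)) * h (s + x) omega t
  + W s * (- v1 (s + x)) * h (s + x) omega t
  + W s * (a' - v (s + x)) * h1 (s + x) omega t.
have cdflux : continuous dflux by rewrite /dflux; continuity.
have <- : itg c d dflux = flux d - flux c.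
  apply: itg_FTC cdflux _ => //.
  move=> s _; rewrite /dflux /flux -mulrDl.
  apply: has_derivM; last by apply: (has_deriv_shift (fun r => h r omega t)); exact: dh1.
  apply: has_derivM; first exact: dW.
  rewrite -[X in has_deriv _ _ X]add0r; apply: has_derivD; first exact: has_deriv_cst.
  by apply: has_derivN; apply: has_deriv_shift; exact: dv.
rewrite mulrC -itgZ; last by continuity.
have cA : continuous (fun s => W1 s * (v (s + x) - a') * h (s + x) omega t + W s * r (s + x)).
  by continuity.
have cB : continuous (fun s => a' * (W s * h1 (s + x) omega t)) by continuity.
have cC : continuous (fun s => W s * h3 (s + x) omega t) by continuity.
rewrite /frame_itg -itgD// -itgD//.
by apply: eq_itg => s _; rewrite /dflux eqh; ring.
Qed.

End MovingFrame.

(** * Solutions of the Kuramoto-Sakaguchi equation *)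

Section Solution.
Context {R : realType}.
Local Notation leb := (@lebesgue_measure R).
Local Notation leb2 := (leb \x leb)%E.
Local Notation mR := (measurableTypeR R).
Variables (K M : R) (g : R -> R) (f0 : R -> R -> R) (f : R -> R -> R -> R).
Hypothesis KS : KS_C1_solution K g f0 f.
Hypothesis M0 : 0 < M.
Hypothesis suppg : supp g `<=` `]- M, M[.

Let twopi_gt0 : 0 < 2 * pi :> R.
Proof. by rewrite mulr_gt0// pi_gt0. Qed.

(** * The velocity field and the regularity of the solution *)

Definition vel (t omega theta : R) : R :=
  omega - K * (sin theta * order_re f t - cos theta * order_im f t).

(** The [theta]-derivative of [vel], the same for every [omega]. *)
Definition vel1 (t theta : R) : R :=
  - (K * (cos theta * order_re f t + sin theta * order_im f t)).

(* Extending evenly to negative times makes the solution continuous everywhere. *)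
Definition even_ext (theta omega t : R) : R := f theta omega `|t|.

Lemma even_ext_continuous : continuous (uncurry3 even_ext).
Proof.
have [C0 _ _] := KS_C1 KS.
move/subspace_continuousP : C0 => C0 p.
pose k (p : R * R * R) : R * R * R := (p.1.1, p.1.2, `|p.2|).
have ck : continuous k by rewrite /k; continuity.
have kp : [set p : R * R * R | 0 <= p.2] (k p) by rewrite /k/= normr_ge0.
move=> U HU; have H : \forall q \near k p, 0 <= q.2 -> U (uncurry3 f q).
  exact: (C0 (k p) kp U HU).
have {}H : \forall q \near p, 0 <= (k q).2 -> U (uncurry3 f (k q)) by exact: ck p _ H.
suff : \forall q \near p, U (uncurry3 even_ext q) by [].
by move: H; apply: filterS => q; apply; rewrite /k/= normr_ge0.
Qed.

Lemma solution_slice2_continuous t : 0 <= t ->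
  continuous (fun p : R * R => f p.1 p.2 t).
Proof.
move=> t0 p.
have := continuous_at_curry3 even_ext fst snd (fun=> t) p (even_ext_continuous _).
rewrite /even_ext (ger0_norm t0); apply; continuity.
Qed.

Lemma solution_slice_continuous t omega : 0 <= t -> continuous (fun theta => f theta omega t).
Proof.
move=> t0 s; apply: (continuous_at_comp (fun s => (s, omega)) (fun p : R * R => f p.1 p.2 t)).
  by continuity.
exact: solution_slice2_continuous.
Qed.

Lemma solution_C1 : C1_theta_t f (d_theta f) (d_t f).
Proof.
have [_ D P] := KS_C1 KS.
split => theta omega t t0.
- have c := even_ext_continuous (theta, omega, t).
  rewrite /prop_for /continuous_at.
  have -> : uncurry3 f (theta, omega, t) = uncurry3 even_ext (theta, omega, t).
    by rewrite /uncurry3/= /even_ext gtr0_norm.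
  apply: cvg_trans c; apply: near_eq_cvg.
  have := near_gt0_snd (theta, omega) t t0; apply: filterS => p p0.
  by rewrite /uncurry3 /even_ext gtr0_norm.
- by have [] := P (theta, omega, t) t0.
- by have [] := P (theta, omega, t) t0.
- have [d _ _] := D theta omega t t0.
  by rewrite /has_deriv /d_theta derive1E; exact/derivableP.
- have [_ _ d] := D theta omega t t0.
  by rewrite /has_deriv /d_t derive1E; exact/derivableP.
Qed.

Let mtorus : measurable (torus : set mR).
Proof. exact: measurable_itv. Qed.

Lemma solution_integrable t : 0 <= t ->
  leb2.-integrable (torus `*` setT) (EFin \o (fun p : R * R => f p.1 p.2 t)).
Proof.
move=> t0; apply/integrableP; split.
  apply/measurable_EFinP; apply: measurable_funTS.
  by apply: continuous_measurable_fun2; exact: solution_slice2_continuous.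
have -> : (\int[leb2]_(p in torus `*` setT) `|(EFin \o (fun p => f p.1 p.2 t)) p| =
           \int[leb2]_(p in torus `*` setT) (f p.1 p.2 t)%:E)%E.
  by apply: eq_integral => p _ /=; rewrite ger0_norm// (KS_ge0 KS).
by rewrite (KS_mass1 KS)// ltry.
Qed.

(** Fubini after expanding [sin (theta - s)]. Integrability comes from the total mass, not from
    compact support in [omega]: that support is a consequence of [solution_equation], which rests on
    this identity. *)
Lemma velocityE theta omega t : 0 <= t ->
  velocity K f theta omega t = vel t omega theta.
Proof.
move=> t0; have ih := solution_integrable t t0.
have csin : continuous (fun s : R => sin (theta - s)) by continuity.
have ccos : continuous (@cos R) by exact: continuous_cos.
have csin' : continuous (@sin R) by exact: continuous_sin.
have [_ E] := Rintegral_density torus (fun s => sin (theta - s))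
  (fun p => f p.1 p.2 t) mtorus csin (fun=> sin_max _) ih.
have [i1 _] := Rintegral_density torus (@cos R)
  (fun p => f p.1 p.2 t) mtorus ccos (@cos_max R) ih.
have [i2 _] := Rintegral_density torus (@sin R)
  (fun p => f p.1 p.2 t) mtorus csin' (@sin_max R) ih.
rewrite /velocity /vel /local_density E; congr (_ - K * _).
have mT : measurable (torus `*` setT : set (mR * mR)) by exact: measurableX.
rewrite /order_re /order_im -(RintegralZl _ mT i1) -(RintegralZl _ mT i2).
have j1 : leb2.-integrable (torus `*` setT)
    (EFin \o (fun p => sin theta * (cos p.1 * f p.1 p.2 t))).
  exact: (integrableZl mT (sin theta) i1).
have j2 : leb2.-integrable (torus `*` setT)
    (EFin \o (fun p => cos theta * (sin p.1 * f p.1 p.2 t))).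
  exact: (integrableZl mT (cos theta) i2).
rewrite -(RintegralB mT j1 j2); apply: eq_Rintegral => p _.
by rewrite sinB; ring.
Qed.

Lemma vel_continuous t omega : continuous (vel t omega).
Proof. by rewrite /vel; continuity. Qed.

Lemma vel1_continuous t : continuous (vel1 t).
Proof. by rewrite /vel1; continuity. Qed.

Lemma vel_deriv t omega theta : has_deriv (vel t omega) theta (vel1 t theta).
Proof.
have h1 := has_deriv_sin _ _ _ (has_deriv_id theta).
have h2 := has_deriv_cos _ _ _ (has_deriv_id theta).
have h3 := has_derivM _ _ _ _ _ h1 (has_deriv_cst (order_re f t) theta).
have h4 := has_derivM _ _ _ _ _ h2 (has_deriv_cst (order_im f t) theta).
have h5 := has_derivD _ _ _ _ _ (has_deriv_cst omega theta)
  (has_derivN _ _ _ (has_derivZ K _ _ _ (has_derivD _ _ _ _ _ h3 (has_derivN _ _ _ h4)))).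
rewrite /vel /vel1; set l := (X in has_deriv _ _ X) in h5 *.
have -> : - (K * (cos theta * order_re f t + sin theta * order_im f t)) = l.
  by rewrite /l; ring.
exact: h5.
Qed.

Lemma solution_equation theta omega t : 0 < t ->
  d_t f theta omega t =
  0 - (vel1 t theta * f theta omega t + vel t omega theta * d_theta f theta omega t).
Proof.
move=> t0; have := KS_equation KS theta omega t0.
have -> : d_theta (fun s w r => velocity K f s w r * f s w r) theta omega t =
    vel1 t theta * f theta omega t + vel t omega theta * d_theta f theta omega t.
  have [_ _ _ d1 _] := solution_C1.
  have [_ <-] := has_deriv_derive1 _ _ _
    (has_derivM _ _ _ _ _ (vel_deriv t omega theta) (d1 theta omega t t0)).
  have E : (fun s => velocity K f s omega t * f s omega t) =
           (fun s => vel t omega s * f s omega t).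
    by apply/funext => s; rewrite velocityE// ltW.
  by rewrite [LHS]/d_theta E.
by move=> /eqP; rewrite addr_eq0 => /eqP ->; rewrite sub0r.
Qed.

Lemma solution_periodic theta omega t : 0 <= t ->
  f (theta + 2 * pi) omega t = f theta omega t.
Proof. by move=> t0; exact: (KS_periodic KS). Qed.

Lemma vel_periodic t omega theta : vel t omega (theta + 2 * pi) = vel t omega theta.
Proof. by rewrite /vel mulr_natl cosD2pi sinD2pi. Qed.

Lemma integral_torus (F : R -> R) : continuous F ->
  \int[leb]_(x in torus) F x = itg 0 (2 * pi) F.
Proof.
move=> cF; apply: Rintegral_itv_bndo_bndc.
apply: integrableS (itg_integrable 0 (2 * pi) F cF) => //.
by apply: subset_itvl; rewrite bnd_simp.
Qed.

Lemma even_ext_slice_continuous t omega : continuous (fun theta => even_ext theta omega t).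
Proof. by apply: solution_slice_continuous. Qed.

Lemma marginal omega t : 0 <= t -> itg 0 (2 * pi) (fun theta => f theta omega t) = g omega.
Proof.
move=> t0.
have H0 : itg 0 (2 * pi) (fun theta => f theta omega 0) = g omega.
  rewrite -integral_torus; last exact: solution_slice_continuous.
  rewrite /Rintegral; under eq_integral do rewrite (KS_initial KS).
  by rewrite (KS_marginal KS omega).
pose G s := itg 0 (2 * pi) (fun theta => even_ext theta omega s).
have cG : continuous G.
  move=> s; apply: (@itg_continuous R R s 0 (2 * pi) (fun s theta => even_ext theta omega s)).
  - exact: ltW.
  - by near=> r; exact: even_ext_slice_continuous.
  - by move=> y _; apply: continuous_at_curry3; [exact: even_ext_continuous|continuity..].
have [c1 _ c3 d1 d3] := solution_C1.
have dG s : 0 < s -> has_deriv G s 0.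
  move=> s0.
  have -> : 0 = itg 0 (2 * pi) (fun theta => d_t f theta omega s).
    pose Fl theta := - (vel s omega theta * f theta omega s).
    transitivity (Fl (2 * pi) - Fl 0).
      rewrite /Fl -[in LHS](subrr (Fl 0)) /Fl.
      by rewrite -[2 * pi]add0r vel_periodic solution_periodic// ltW.
    symmetry; apply: itg_FTC.
    - exact: ltW.
    - by move=> theta; apply: continuous_at_curry3; [exact: c3|continuity..].
    - move=> theta _; have -> := solution_equation theta omega s s0; rewrite sub0r.
      by apply: has_derivN; apply: has_derivM; [exact: vel_deriv|exact: d1].
  have : has_deriv (fun r => itg 0 (2 * pi) (fun theta => f theta omega r)) s
      (itg 0 (2 * pi) (fun theta => d_t f theta omega s)).
    apply: (@itg_has_deriv R s 0 (2 * pi) (fun r theta => f theta omega r)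
      (fun r theta => d_t f theta omega r)).
    - exact: ltW.
    - have := near_gt0 s s0; apply: filterS => r r0; split.
        by apply: solution_slice_continuous; exact: ltW.
      by move=> y _; exact: d3.
    - by move=> theta; apply: continuous_at_curry3; [exact: c3|continuity..].
    - by move=> y _; apply: continuous_at_curry3; [exact: c3|continuity..].
  apply: near_eq_is_derive; have := near_gt0 s s0; apply: filterS => r r0.
  by rewrite /G /even_ext gtr0_norm.
have -> : itg 0 (2 * pi) (fun theta => f theta omega t) = G t.
  by rewrite /G /even_ext ger0_norm.
rewrite -H0; have -> : itg 0 (2 * pi) (fun theta => f theta omega 0) = G 0.
  by rewrite /G /even_ext normr0.
have dG' x : x \in `]0, t[ -> is_derive x (1 : R) G 0.
  by rewrite in_itv/= => /andP[x0 _]; exact: dG.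
have [c _] := MVT_segment t0 dG' (continuous_subspaceT cG).
by rewrite mul0r => /eqP; rewrite subr_eq0 => /eqP.
Unshelve. all: by end_near. Qed.

Lemma solution_eq0 theta omega t : 0 <= t -> M <= `|omega| -> f theta omega t = 0.
Proof.
move=> t0 Mo.
have g0 : g omega = 0.
  apply/eqP; apply: contraT => g0.
  have /suppg : supp g omega by apply: subset_closure.
  by rewrite /= in_itv/= -ltr_norml ltNge Mo.
have cf := solution_slice_continuous t omega t0.
(* The period starts at [theta], so that the point in question belongs to the interval of
   integration. *)
have I0 : itg theta (theta + 2 * pi) (fun s => f s omega t) = 0.
  rewrite (@itg_periodic R (fun s => f s omega t) _ _ 0)//.
    by rewrite add0r marginal.
  by move=> y; exact: solution_periodic.
apply: (@itg_eq0P R theta (theta + 2 * pi) (fun s => f s omega t)) => //.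
- by rewrite ltrDl.
- by move=> x _; exact: KS_ge0 KS _ _ _ t0.
- by rewrite lexx lerDl ltW.
Qed.

Lemma weighted_mass_itg (w : R -> R) a b (b0 : bool) t : 0 <= t -> continuous w -> a < b ->
  \int[leb2]_(p in [set` Interval (BSide b0 a) (BLeft b)] `*` setT)
     (w p.1 * f p.1 p.2 t) =
  itg (- M) M (fun omega => frame_itg a b w f 0 omega t).
Proof.
move=> t0 cw ab.
have cF : continuous (fun p : R * R => w p.1 * f p.1 p.2 t).
  have cf := solution_slice2_continuous t t0.
  move=> p; apply: continuous_atM; last exact: cf.
  by apply: (continuous_at_comp fst w); continuity.
have F0 x y : M <= `|y| -> w x * f x y t = 0.
  by move=> My; rewrite solution_eq0// mulr0.
have := @Rintegral_setX_itg R M a b b0 _ cF F0 ab.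
move=> ->; apply: eq_itg => omega _; apply: eq_itg => s _; by rewrite addr0.
Qed.

Lemma order_re_itg t : 0 <= t ->
  order_re f t = itg (- M) M (fun omega => frame_itg 0 (2 * pi) (@cos R) f 0 omega t).
Proof. by move=> t0; apply: (weighted_mass_itg (@cos R)) => //; exact: continuous_cos. Qed.

Lemma order_im_itg t : 0 <= t ->
  order_im f t = itg (- M) M (fun omega => frame_itg 0 (2 * pi) (@sin R) f 0 omega t).
Proof. by move=> t0; apply: (weighted_mass_itg (@sin R)) => //; exact: continuous_sin. Qed.

Lemma total_mass_itg t : 0 <= t ->
  1 = itg (- M) M (fun omega => frame_itg 0 (2 * pi) (fun=> 1) f 0 omega t).
Proof.
move=> t0; rewrite -(weighted_mass_itg (fun=> 1) _ _ true)//; last by continuity.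
rewrite /Rintegral; under eq_integral do rewrite mul1r.
by rewrite (KS_mass1 KS).
Qed.

Lemma mass_arc_itg c l t : 0 <= t -> 0 < l ->
  mass f (circle_arc c l) t = itg (- M) M (fun omega => frame_itg (- l) l (fun=> 1) f c omega t).
Proof.
move=> t0 l0; rewrite /mass /circle_arc.
transitivity (itg (- M) M (fun omega => frame_itg (c - l) (c + l) (fun=> 1) f 0 omega t)).
  rewrite -(weighted_mass_itg (fun=> 1) _ _ false)//; [|by continuity|by lra].
  by apply: eq_Rintegral => p _; rewrite mul1r.
apply: eq_itg => omega _.
have cf := solution_slice_continuous t omega t0.
transitivity (itg (- l + c) (l + c) (fun s => f s omega t)).
  rewrite addrC [l + c]addrC; apply: eq_itg => s _; by rewrite mul1r addr0.
rewrite -itg_shift//; last by lra.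
by apply: eq_itg => s _; rewrite mul1r.
Qed.

Lemma L2_mass_arc_itg c l omega t : 0 <= t -> 0 < l ->
  L2_mass f (circle_arc c l) omega t =
  frame_itg (- l) l (fun=> 1) (fun x w s => f x w s ^+ 2) c omega t.
Proof.
move=> t0 l0; rewrite /L2_mass /circle_arc.
have cf := solution_slice_continuous t omega t0.
have cf2 : continuous (fun x => f x omega t ^+ 2) by continuity.
transitivity (itg (- l + c) (l + c) (fun x => f x omega t ^+ 2)).
  rewrite addrC [l + c]addrC /itg /Rintegral.
  under eq_integral do rewrite real_normK ?num_real//.
  rewrite -(@integral_itv_bndoo _ _ _ _ true false)//.
  by apply/measurable_EFinP/measurable_funTS; exact: continuous_measurable_fun.
rewrite -itg_shift//; last by lra.
by apply: eq_itg => s _; rewrite mul1r.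
Qed.

(** * Expectations under the solution and the motion of the order parameter *)

Definition expect (t : R) (w : R -> R -> R) : R :=
  itg (- M) M (fun omega => itg 0 (2 * pi) (fun theta => w omega theta * f theta omega t)).

Let MM : - M <= M.
Proof. by move: (ltW M0); lra. Qed.

Let weight_continuous (w : R -> R -> R) t : 0 <= t ->
  continuous (fun p : R * R => w p.1 p.2) ->
  (forall omega, continuous (fun theta => w omega theta * f theta omega t)) /\
  continuous (fun omega => itg 0 (2 * pi) (fun theta => w omega theta * f theta omega t)).
Proof.
move=> t0 cw.
have c2 : continuous (fun p : R * R => w p.1 p.2 * f p.2 p.1 t).
  move=> p; apply: continuous_atM; first exact: cw.
  by apply: (continuous_at_curry2 (fun x y => f x y t)); continuity;
    exact: solution_slice2_continuous.
have c1 omega : continuous (fun theta => w omega theta * f theta omega t).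
  move=> s.
  apply: (continuous_at_comp (fun theta => (omega, theta)) (fun p => w p.1 p.2 * f p.2 p.1 t)).
    by continuity.
  exact: c2.
split=> // omega.
apply: (@itg_continuous R R omega 0 (2 * pi) (fun omega theta => w omega theta * f theta omega t)).
- exact: ltW.
- by near=> y; exact: c1.
- by move=> y _; exact: c2.
Unshelve. all: by end_near. Qed.

Lemma expectD t w1 w2 : 0 <= t ->
  continuous (fun p : R * R => w1 p.1 p.2) ->
  continuous (fun p : R * R => w2 p.1 p.2) ->
  expect t (fun omega theta => w1 omega theta + w2 omega theta) =
  expect t w1 + expect t w2.
Proof.
move=> t0 /(weight_continuous _ _ t0)[c1 k1] /(weight_continuous _ _ t0)[c2 k2].
rewrite /expect -itgD//; apply: eq_itg => omega _; rewrite -itgD//.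
by apply: eq_itg => theta _; rewrite mulrDl.
Qed.

Lemma expectZ (t c : R) (w : R -> R -> R) : 0 <= t -> continuous (fun p : R * R => w p.1 p.2) ->
  expect t (fun omega theta => c * w omega theta) = c * expect t w.
Proof.
move=> t0 /(weight_continuous _ _ t0)[c1 k1].
rewrite /expect -itgZ//; apply: eq_itg => omega _; rewrite -itgZ//.
by apply: eq_itg => theta _; rewrite mulrA.
Qed.

Lemma le_expect t w1 w2 : 0 <= t ->
  continuous (fun p : R * R => w1 p.1 p.2) ->
  continuous (fun p : R * R => w2 p.1 p.2) ->
  (forall omega theta, - M <= omega <= M -> w1 omega theta <= w2 omega theta) ->
  expect t w1 <= expect t w2.
Proof.
move=> t0 /(weight_continuous _ _ t0)[c1 k1] /(weight_continuous _ _ t0)[c2 k2] w12.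
apply: le_itg => // omega oM; apply: le_itg => // theta _.
by apply: ler_wpM2r; [exact: (KS_ge0 KS)|exact: w12].
Qed.

Lemma expect_cst t c : 0 <= t -> expect t (fun _ _ => c) = c.
Proof.
move=> t0; have -> : expect t (fun _ _ => c) = c * expect t (fun _ _ => 1).
  by rewrite -expectZ; [rewrite mulr1|by []|continuity].
rewrite [X in c * X](_ : _ = 1) ?mulr1// [RHS](total_mass_itg t t0).
by apply: eq_itg => omega _; apply: eq_itg => theta _; rewrite addr0.
Qed.

Lemma order_re_expect t : 0 <= t -> order_re f t = expect t (fun _ theta => cos theta).
Proof.
move=> t0; rewrite (order_re_itg t t0).
by apply: eq_itg => omega _; apply: eq_itg => theta _; rewrite addr0.
Qed.

Lemma order_im_expect t : 0 <= t -> order_im f t = expect t (fun _ theta => sin theta).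
Proof.
move=> t0; rewrite (order_im_itg t t0).
by apply: eq_itg => omega _; apply: eq_itg => theta _; rewrite addr0.
Qed.

Lemma expect_vel_continuous t (W : R -> R) : continuous W ->
  continuous (fun p : R * R => W p.2 * vel t p.1 p.2).
Proof.
move=> cW p; rewrite /vel; apply: continuous_atM;
  by [apply: (continuous_at_comp snd W); continuity|continuity].
Qed.

(** The transport formula in a frame at rest: the boundary fluxes at 0 and [2 * pi] cancel by
    periodicity, and only the drift of the weight remains. *)
Lemma expect_deriv (W W1 : R -> R) t : 0 < t -> continuous W -> continuous W1 ->
  (forall s, has_deriv W s (W1 s)) -> W (2 * pi) = W 0 ->
  has_deriv (fun s => itg (- M) M (fun omega => frame_itg 0 (2 * pi) W f 0 omega s)) t
    (expect t (fun omega theta => W1 theta * vel t omega theta)).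
Proof.
move=> t0 cW cW1 dW W2pi.
have twopi0 : 0 <= 2 * pi :> R by exact: ltW.
have MM0 : 0 <= M by exact: ltW.
have := itg_frame_itg_derive _ _ _ twopi0 cW _ _ _ solution_C1 M MM0
  (fun=> 0) 0 t t0 (has_deriv_cst 0 t).
congr (has_deriv _ _ _); apply: eq_itg => omega _.
rewrite (@frame_itg_transport R 0 (2 * pi) W twopi0 cW f (d_theta f) (d_t f) solution_C1
  (vel t omega) (vel1 t) (fun=> 0) W1 0 0 omega t) //.
- have e1 : vel t omega (2 * pi) = vel t omega 0 by rewrite -[2 * pi]add0r vel_periodic.
  have e2 : f (2 * pi) omega t = f 0 omega t.
    by rewrite -[2 * pi]add0r solution_periodic// ltW.
  rewrite !addr0 W2pi e1 e2 subrr add0r; apply: eq_itg => theta _.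
  by rewrite addr0 subr0 mulr0 addr0.
- exact: vel_continuous.
- exact: vel1_continuous.
- by continuity.
- by move=> theta; exact: vel_deriv.
- by move=> theta; exact: solution_equation.
Qed.

Lemma order_re_deriv t : 0 < t -> has_deriv (order_re f) t
  (expect t (fun omega theta => - sin theta * vel t omega theta)).
Proof.
move=> t0.
have cs : continuous (fun theta : R => - sin theta) by continuity.
have := expect_deriv (@cos R) (fun theta => - sin theta) t t0 (@continuous_cos R) cs.
move=> H; have {}H := H (fun s => is_derive_cos s).
have e : cos (2 * pi) = cos 0 :> R by rewrite mulr_natl cos2pi cos0.
apply: near_eq_is_derive (H e); have := near_gt0 t t0; apply: filterS => s s0.
by rewrite (order_re_itg s (ltW s0)).
Qed.

Lemma order_im_deriv t : 0 < t -> has_deriv (order_im f) t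
  (expect t (fun omega theta => cos theta * vel t omega theta)).
Proof.
move=> t0.
have := expect_deriv (@sin R) (@cos R) t t0 (@continuous_sin R) (@continuous_cos R).
move=> H; have {}H := H (fun s => is_derive_sin s).
have e : sin (2 * pi) = sin 0 :> R by rewrite mulr_natl sin2pi sin0.
apply: near_eq_is_derive (H e); have := near_gt0 t t0; apply: filterS => s s0.
by rewrite (order_im_itg s (ltW s0)).
Qed.

(* The angular velocity of the average phase: the imaginary part of
   [(d/dt (R e^{i phi})) e^{- i phi} / R]. *)
Definition phase_speed (t x : R) : R :=
  expect t (fun omega theta => cos (theta - x) * vel t omega theta) / order_amplitude f t.

Lemma vel_phase t x omega theta : is_average_phase f t x ->
  vel t omega theta = omega - K * (order_amplitude f t * sin (theta - x)).
Proof. by case=> e1 e2; rewrite /vel e1 e2 sinB; ring. Qed.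

Lemma vel1_phase t x theta : is_average_phase f t x ->
  vel1 t theta = - (K * (order_amplitude f t * cos (theta - x))).
Proof. by case=> e1 e2; rewrite /vel1 e1 e2 cosB; ring. Qed.

Lemma expect_cos_phase t x : 0 <= t -> is_average_phase f t x ->
  expect t (fun _ theta => cos (theta - x)) = order_amplitude f t.
Proof.
move=> t0 phx.
transitivity (cos x * order_re f t + sin x * order_im f t).
  rewrite order_re_expect// order_im_expect//.
  rewrite -(expectZ t _ _ t0); last by continuity.
  rewrite -(expectZ t _ _ t0); last by continuity.
  rewrite -(expectD t _ _ t0); [|continuity|continuity].
  by apply: eq_itg => o _; apply: eq_itg => theta _; rewrite cosB; ring.
by case: phx => -> ->; rewrite -[RHS]mulr1 -(cos2Dsin2 x); ring.
Qed.

Lemma expect_sin_phase t x : 0 <= t -> is_average_phase f t x ->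
  expect t (fun _ theta => sin (theta - x)) = 0.
Proof.
move=> t0 phx.
transitivity (cos x * order_im f t + (- sin x) * order_re f t).
  rewrite order_re_expect// order_im_expect//.
  rewrite -(expectZ t _ _ t0); last by continuity.
  rewrite -(expectZ t _ _ t0); last by continuity.
  rewrite -(expectD t _ _ t0); [|continuity|continuity].
  by apply: eq_itg => o _; apply: eq_itg => theta _; rewrite sinB; ring.
by case: phx => -> ->; ring.
Qed.

(* Since [sin (theta - x)] has mean zero, [sin cos] may be replaced by [sin (cos - 1)]. *)
Lemma phase_speed_bound t x : 0 <= t -> is_average_phase f t x ->
  let r := order_amplitude f t in
  0 <= K -> 0 < r -> `|phase_speed t x| <= M / r + K * (1 - r).
Proof.
move=> t0 phx r K0 r0.
pose E := expect t (fun omega theta => cos (theta - x) * vel t omega theta).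
have cE : continuous (fun p : R * R => cos (p.2 - x) * vel t p.1 p.2).
  by apply: (expect_vel_continuous t (fun s => cos (s - x))); continuity.
pose w (p : R * R) := M + K * r * (1 - cos (p.2 - x)).
have bound (s : R) : `|s| = 1 -> s * E <= M + K * r * (1 - r).
  move=> s1.
  (* The sine term changes the weight but not its mean; with it the comparison becomes pointwise,
     reducing to [s sin (1 - cos) <= 1 - cos]. The values [s = 1] and [s = -1] together bound the
     absolute value. *)
  have -> : M + K * r * (1 - r) = expect t (fun omega theta =>
      (M + K * r) + ((- (K * r)) * cos (theta - x) + (- s * (K * r)) * sin (theta - x))).
    rewrite (expectD t (fun _ _ => M + K * r) _ t0); [|continuity|continuity].
    rewrite (expectD t (fun _ theta => - (K * r) * cos (theta - x)) _ t0); [|continuity|continuity].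
    rewrite !(expectZ t _ _ t0); [|continuity|continuity].
    by rewrite (expect_cst t _ t0) (expect_cos_phase t x t0 phx)
      (expect_sin_phase t x t0 phx) -/r; ring.
  rewrite /E -(expectZ t _ _ t0); last exact: cE.
  apply: (le_expect t _ _ t0).
  - by move=> p; apply: continuous_atM; [continuity|exact: cE].
  - by continuity.
  - move=> omega theta oM; rewrite (vel_phase t x _ _ phx) -/r.
    set c := cos _; set si := sin _.
    have c1 : c <= 1 by exact: cos_le1.
    have c2 : -1 <= c by exact: cos_geN1.
    have sco : s * c * omega <= M.
      apply: (le_trans (ler_norm _)); rewrite !normrM s1 mul1r.
      rewrite -[leRHS]mul1r; apply: ler_pM => //; first exact: cos_max.
      by rewrite ler_norml.
    have ssi : s * si * (1 - c) <= 1 - c.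
      rewrite ler_piMl ?subr_ge0//; apply: (le_trans (ler_norm _)).
      by rewrite normrM s1 mul1r sin_max.
    have Kr : 0 <= K * r by rewrite mulr_ge0// ltW.
    have := ler_wpM2l Kr ssi; nra.
have b1 := bound 1 (normr1 _); have b2 := bound (-1) (normrN1 _).
rewrite /phase_speed -/E normrM normfV (gtr0_norm r0) ler_pdivrMr//.
rewrite mulrDl divfK ?gt_eqF// ler_norml.
rewrite mul1r in b1; rewrite mulN1r in b2; rewrite mulrAC.
by apply/andP; split; lra.
Qed.

(** Once whole periods are removed, the difference lies in [[0, 2 * pi[] and has cosine 1; the
    half-angle formula then forces it to vanish. *)
Lemma trig_eq_shift (x y : R) : cos x = cos y -> sin x = sin y ->
  exists k : int, x = y + k%:~R * (2 * pi).
Proof.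
move=> cxy sxy; pose k := Num.floor ((x - y) / (2 * pi)).
exists k; pose w := x - y - k%:~R * (2 * pi).
suff w0 : w = 0 by move: w0; rewrite /w; lra.
have w1 : 0 <= w < 2 * pi.
  have := floor_itv ((x - y) / (2 * pi)); rewrite -/k.
  by rewrite ler_pdivlMr// ltr_pdivrMr// intrD mulrDl /w mul1r => /andP[? ?];
    apply/andP; split; lra.
have cw : cos w = 1.
  have cp z : cos (z + 2 * pi) = cos z :> R by rewrite mulr_natl cosD2pi.
  have -> : w = x - y + (- k)%:~R * (2 * pi) by rewrite /w mulrNz mulNr.
  rewrite (@periodic_int R (@cos R)) // cosB cxy sxy.
  by have := cos2Dsin2 y; rewrite !expr2.
case/andP: w1 => w1 w2.
apply/eqP; rewrite eq_le w1 andbT leNgt; apply/negP => w0.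
have := @sin_gt0_pi R (w / 2) => /(_ ltac:(lra)) s0.
have : cos w = 1 - sin (w / 2) ^+ 2 *+ 2.
  have {1}-> : w = (w / 2) *+ 2 by rewrite mulr2n; lra.
  by rewrite cos_mulr2n cos2sin2; ring.
rewrite cw; have := mulr_gt0 s0 s0; rewrite -expr2 mulr2n; lra.
Qed.

(** * Continuity up to time zero *)

Lemma even_frame_continuous c d (W : R -> R) omega x t : c <= d -> continuous W ->
  {for (x, omega, t), continuous (uncurry3 (frame_itg c d W even_ext))}.
Proof.
move=> cd cW; apply: (@frame_itg_continuous R c d W cd cW (fun=> True) even_ext) => //.
  by move=> *; near=> s.
by move=> *; exact: even_ext_continuous.
Unshelve. all: by end_near. Qed.

Definition square_density (theta omega t : R) : R := f theta omega t ^+ 2.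

Lemma even_frame_square_continuous c d omega x t : c <= d ->
  {for (x, omega, t), continuous (uncurry3
     (frame_itg c d (fun=> 1) (fun theta w s => even_ext theta w s ^+ 2)))}.
Proof.
move=> cd; have c1 : continuous (fun _ : R => 1 : R) by continuity.
apply: (@frame_itg_continuous R c d _ cd c1 (fun=> True)
  (fun theta w s => even_ext theta w s ^+ 2)) => //.
  by move=> *; near=> s.
move=> theta w s _; have := even_ext_continuous (theta, w, s); rewrite /uncurry3 => H.
exact: continuous_atX.
Unshelve. all: by end_near. Qed.

Lemma itg_even_frame_continuous c d (W : R -> R) x t : c <= d -> continuous W ->
  {for (x, t), continuous (fun p : R * R =>
     itg (- M) M (fun omega => frame_itg c d W even_ext p.1 omega p.2))}.
Proof.
move=> cd cW.
apply: (@itg_continuous R (R * R)%type (x, t) (- M) M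
  (fun p omega => frame_itg c d W even_ext p.1 omega p.2)) => //.
- near=> p; move=> omega.
  by apply: continuous_at_curry3; [exact: even_frame_continuous|continuity..].
- by move=> y _; apply: continuous_at_curry3; [exact: even_frame_continuous|continuity..].
Unshelve. all: by end_near. Qed.

Definition even_re (t : R) := order_re f `|t|.
Definition even_im (t : R) := order_im f `|t|.

Lemma even_re_continuous : continuous even_re.
Proof.
have -> : even_re = fun t =>
    itg (- M) M (fun omega => frame_itg 0 (2 * pi) (@cos R) even_ext 0 omega t).
  by apply/funext => t; rewrite /even_re (order_re_itg _ (normr_ge0 _)).
move=> t; apply: (continuous_at_comp (fun t => (0, t)) (fun p : R * R =>
     itg (- M) M (fun omega => frame_itg 0 (2 * pi) (@cos R) even_ext p.1 omega p.2))).
  by continuity.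
by apply: itg_even_frame_continuous; [exact: ltW|exact: continuous_cos].
Qed.

Lemma even_im_continuous : continuous even_im.
Proof.
have -> : even_im = fun t =>
    itg (- M) M (fun omega => frame_itg 0 (2 * pi) (@sin R) even_ext 0 omega t).
  by apply/funext => t; rewrite /even_im (order_im_itg _ (normr_ge0 _)).
move=> t; apply: (continuous_at_comp (fun t => (0, t)) (fun p : R * R =>
     itg (- M) M (fun omega => frame_itg 0 (2 * pi) (@sin R) even_ext p.1 omega p.2))).
  by continuity.
by apply: itg_even_frame_continuous; [exact: ltW|exact: continuous_sin].
Qed.

Lemma even_amplitude_continuous : continuous (fun t : R => order_amplitude f `|t|).
Proof.
have c1 := even_re_continuous; have c2 := even_im_continuous.
move=> t; apply: (continuous_at_comp (fun t => even_re t ^+ 2 + even_im t ^+ 2) Num.sqrt).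
  by continuity.
exact: sqrt_continuous.
Qed.

(** * A regular representative of the average phase *)

Section Lift.
Variable phi : R -> R.
Hypothesis phase : forall t, 0 <= t -> is_average_phase f t (phi t).
Variable t0 : R.
Hypotheses (t00 : 0 <= t0) (r0 : 0 < order_amplitude f t0).

(** [num] and [den] are the imaginary and real parts of the order parameter rotated by [- phi t0].
    At [t0] they equal 0 and the positive amplitude, so [atan] of the quotient is the angle of the
    rotated parameter nearby. *)
Let num s := even_im s * cos (phi t0) - even_re s * sin (phi t0).
Let den s := even_re s * cos (phi t0) + even_im s * sin (phi t0).

(* [phi] is only determined modulo [2 pi] and need not be continuous; near [t0] this is
   a regular representative. *)
Definition lift s := phi t0 + atan (num s / den s).

Let num0 : num t0 = 0.
Proof.
by rewrite /num /even_im /even_re (ger0_norm t00); case: (phase _ t00) => -> ->; ring.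
Qed.

Let den0 : den t0 = order_amplitude f t0.
Proof.
rewrite /den /even_im /even_re (ger0_norm t00); case: (phase _ t00) => -> ->.
by rewrite -[RHS]mulr1 -(cos2Dsin2 (phi t0)); ring.
Qed.

Lemma lift_at : lift t0 = phi t0.
Proof. by rewrite /lift num0 mul0r atan0 addr0. Qed.

Let num_continuous : continuous num.
Proof.
by have c1 := even_re_continuous; have c2 := even_im_continuous; rewrite /num; continuity.
Qed.

Let den_continuous : continuous den.
Proof.
by have c1 := even_re_continuous; have c2 := even_im_continuous; rewrite /den; continuity.
Qed.

Lemma lift_continuous : continuous_at t0 lift.
Proof.
apply: continuous_atD; first by continuity.
apply: (continuous_at_comp (fun s => num s / den s) (@atan R)); last exact: continuous_atan.
apply: continuous_atM; first exact: num_continuous.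
by apply: continuous_atV; [rewrite den0 gt_eqF|exact: den_continuous].
Qed.

Lemma lift_deriv : 0 < t0 -> has_deriv lift t0 (phase_speed t0 (phi t0)).
Proof.
move=> t0p.
have e1 : has_deriv even_re t0 (expect t0 (fun omega theta => - sin theta * vel t0 omega theta)).
  apply: near_eq_is_derive (order_re_deriv _ t0p).
  by have := near_gt0 _ t0p; apply: filterS => s s0; rewrite /even_re gtr0_norm.
have e2 : has_deriv even_im t0 (expect t0 (fun omega theta => cos theta * vel t0 omega theta)).
  apply: near_eq_is_derive (order_im_deriv _ t0p).
  by have := near_gt0 _ t0p; apply: filterS => s s0; rewrite /even_im gtr0_norm.
have cc := has_deriv_cst (cos (phi t0)) t0; have cs := has_deriv_cst (sin (phi t0)) t0.
have dnum : has_deriv num t0 _ :=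
  has_derivD _ _ _ _ _ (has_derivM _ _ _ _ _ e2 cc)
    (has_derivN _ _ _ (has_derivM _ _ _ _ _ e1 cs)).
have dden : has_deriv den t0 _ :=
  has_derivD _ _ _ _ _ (has_derivM _ _ _ _ _ e1 cc) (has_derivM _ _ _ _ _ e2 cs).
have den_neq0 : den t0 != 0 by rewrite den0 gt_eqF.
have dinv := is_deriveV den_neq0 dden.
have dq := has_derivM _ _ _ _ _ dnum dinv.
have da := has_deriv_comp _ _ _ _ _ dq (is_derive1_atan _).
have := has_derivD _ _ _ _ _ (has_deriv_cst (phi t0) t0) da.
have cW (W : R -> R) : continuous W -> continuous (fun p : R * R => W p.2 * vel t0 p.1 p.2).
  exact: expect_vel_continuous.
have k1 : continuous (fun p : R * R => cos p.2 * vel t0 p.1 p.2).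
  by apply: cW; exact: continuous_cos.
have k2 : continuous (fun p : R * R => - sin p.2 * vel t0 p.1 p.2).
  by apply: (cW (fun s => - sin s)); continuity.
have E : expect t0 (fun omega theta => cos (theta - phi t0) * vel t0 omega theta) =
    cos (phi t0) * expect t0 (fun omega theta => cos theta * vel t0 omega theta) +
    - sin (phi t0) * expect t0 (fun omega theta => - sin theta * vel t0 omega theta).
  rewrite -(expectZ t0 _ _ t00); last exact: k1.
  rewrite -(expectZ t0 _ _ t00); last exact: k2.
  rewrite -(expectD t0 _ _ t00); last 2 first.
  - by move=> p; apply: continuous_atM; [continuity|exact: k1].
  - by move=> p; apply: continuous_atM; [continuity|exact: k2].
  by apply: eq_itg => o _; apply: eq_itg => theta _; rewrite cosB; ring.
congr (has_deriv _ _ _).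
(* As [num] vanishes at [t0], the quotient rule keeps only the derivative of [num] over [den], and
   [atan] has slope 1 there. *)
rewrite num0 !mulr0 !mul0r !addr0 add0r expr0n/= addr0 invr1 mul1r /phase_speed E den0.
by congr (_ / _); ring.
Qed.

(** As long as [den] is positive the rotated order parameter lies in the right half-plane, where
    [atan] recovers the signs of both cosine and sine. *)
Lemma lift_phase : \forall s \near t0, 0 <= s ->
  cos (lift s) = cos (phi s) /\ sin (lift s) = sin (phi s).
Proof.
have /cvgrPdist_lt/(_ _ r0) n1 := den_continuous t0.
rewrite den0 in n1; near=> s => s0.
have d0 : 0 < den s.
  have : `|order_amplitude f t0 - den s| < order_amplitude f t0 by near: s; exact: n1.
  by rewrite ltr_norml => /andP[_]; lra.
set r := order_amplitude f s.
have [e1 e2] := phase _ s0.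
have er : r ^+ 2 = num s ^+ 2 + den s ^+ 2.
  rewrite /r /order_amplitude sqr_sqrtr ?addr_ge0 ?sqr_ge0//.
  rewrite /num /den /even_im /even_re (ger0_norm s0).
  by rewrite -[LHS]mulr1 -(cos2Dsin2 (phi t0)); ring.
have rp : 0 < r.
  by rewrite lt0r sqrtr_ge0 andbT -(sqrf_eq0 r) er gt_eqF// ltr_wpDl ?sqr_ge0 ?exprn_gt0.
have dE : den s = r * cos (phi s - phi t0).
  by rewrite /den /even_im /even_re (ger0_norm s0) e1 e2 cosB -/r; ring.
have nE : num s = r * sin (phi s - phi t0).
  by rewrite /num /even_im /even_re (ger0_norm s0) e1 e2 sinB -/r; ring.
set q := num s / den s.
have ca : cos (atan q) = den s / r.
  rewrite cos_atan; have -> : 1 + q ^+ 2 = (r / den s) ^+ 2.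
    by rewrite /q !expr_div_n er; field; rewrite gt_eqF.
  by rewrite sqrtr_sqr ger0_norm ?divr_ge0 ?ltW// invf_div.
have cp : 0 < cos (atan q) by rewrite ca divr_gt0.
have sa : sin (atan q) = num s / r.
  have := atanK q; rewrite /tan => /(canRL (divfK (lt0r_neq0 cp))) ->.
  by rewrite ca /q; field; rewrite !gt_eqF.
have rn : r != 0 by rewrite gt_eqF.
have ca' : cos (atan q) = cos (phi s - phi t0) by rewrite ca dE mulrAC divff// mul1r.
have sa' : sin (atan q) = sin (phi s - phi t0) by rewrite sa nE mulrAC divff// mul1r.
rewrite /lift -/q cosD sinD ca' sa' -cosD -sinD.
by rewrite addrC subrK.
Unshelve. all: by end_near. Qed.

(** At each time the two phases differ by a multiple of [2 * pi], which may vary wildly with [s];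
    periodicity absorbs it. *)
Lemma lift_shift : \forall s \near t0, 0 <= s ->
  forall theta omega, f (theta + lift s) omega s = f (theta + phi s) omega s.
Proof.
have := lift_phase; apply: filterS => s H s0 theta omega.
have [c1 c2] := H s0; have [k ->] := trig_eq_shift _ _ c1 c2.
rewrite addrA; apply: (@periodic_int R (fun x => f x omega s)).
by move=> y; exact: solution_periodic.
Qed.

End Lift.

Lemma solution_square_C1 : C1_theta_t square_density
  (fun theta omega t => d_theta f theta omega t * f theta omega t
                        + f theta omega t * d_theta f theta omega t)
  (fun theta omega t => d_t f theta omega t * f theta omega t
                        + f theta omega t * d_t f theta omega t).
Proof.
have [c c1 c3 d1 d3] := solution_C1.
split => theta omega t t0.
- have H := c theta omega t t0; exact: continuous_atX.
- have H := c theta omega t t0; have H1 := c1 theta omega t t0.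
  by apply: continuous_atD; apply: continuous_atM.
- have H := c theta omega t t0; have H1 := c3 theta omega t t0.
  by apply: continuous_atD; apply: continuous_atM.
- by have H := d1 theta omega t t0; have := has_derivM _ _ _ _ _ H H.
- by have H := d3 theta omega t t0; have := has_derivM _ _ _ _ _ H H.
Qed.

(** * Derivatives in the frame of the average phase *)

Section PhaseFrame.
Variable phi : R -> R.
Hypothesis phase : forall t, 0 <= t -> is_average_phase f t (phi t).
Variable t : R.
Hypotheses (t0 : 0 <= t) (r0 : 0 < order_amplitude f t).
Let r := order_amplitude f t.
Let nu := phase_speed t (phi t).

(** The reflected time makes this hold on a full neighbourhood of [t], also when [t] is 0. *)
Lemma lift_shift_norm : \forall s \near t, forall theta omega,
  f (theta + lift phi t s) omega `|s| = f (theta + phi `|s|) omega `|s|.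
Proof.
have H := lift_shift phi phase t t0 r0.
have cn : continuous_at t (fun s : R => `|s|) by continuity.
have H' : nbhs `|t| (fun s => 0 <= s -> forall theta omega,
    f (theta + lift phi t s) omega s = f (theta + phi s) omega s).
  by rewrite (ger0_norm t0); exact: H.
have {}H : \forall s \near t, 0 <= `|s| -> forall theta omega,
    f (theta + lift phi t `|s|) omega `|s| = f (theta + phi `|s|) omega `|s|.
  exact: (cn _ H').
apply: filterS H => s /(_ (normr_ge0 _)) H theta omega.
by rewrite -H /lift /even_re /even_im normr_id.
Qed.

Let lift_eq : lift phi t t = phi t.
Proof. exact: lift_at. Qed.

Lemma phase_frame_continuous c d (W : R -> R) omega : c <= d -> continuous W ->
  continuous_at t (fun s : R => frame_itg c d W f (phi `|s|) omega `|s|).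
Proof.
move=> cd cW.
have cl := lift_continuous phi phase t t0 r0.
have H : continuous_at t (fun s => frame_itg c d W even_ext (lift phi t s) omega s).
  by apply: continuous_at_curry3; [exact: even_frame_continuous|continuity..].
apply: continuous_at_near H; apply: filterS lift_shift_norm => s H.
by apply: eq_itg => x _; rewrite /even_ext H.
Qed.

Lemma phase_square_continuous c d omega : c <= d ->
  continuous_at t (fun s : R => frame_itg c d (fun=> 1) square_density (phi `|s|) omega `|s|).
Proof.
move=> cd.
have cl := lift_continuous phi phase t t0 r0.
have H : continuous_at t (fun s => frame_itg c d (fun=> 1)
    (fun theta w s => even_ext theta w s ^+ 2) (lift phi t s) omega s).
  by apply: continuous_at_curry3; [exact: even_frame_square_continuous|continuity..].
apply: continuous_at_near H; apply: filterS lift_shift_norm => s H.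
by apply: eq_itg => x _; rewrite /square_density /even_ext H.
Qed.

Lemma phase_itg_frame_continuous c d (W : R -> R) : c <= d -> continuous W ->
  continuous_at t (fun s : R =>
    itg (- M) M (fun omega => frame_itg c d W f (phi `|s|) omega `|s|)).
Proof.
move=> cd cW.
have cl := lift_continuous phi phase t t0 r0.
have H : continuous_at t (fun s => itg (- M) M (fun omega =>
    frame_itg c d W even_ext (lift phi t s) omega s)).
  apply: (continuous_at_comp (fun s => (lift phi t s, s)) (fun p : R * R => itg (- M) M (fun omega =>
    frame_itg c d W even_ext p.1 omega p.2))); first by continuity.
  exact: itg_even_frame_continuous.
apply: continuous_at_near H; apply: filterS lift_shift_norm => s H.
by apply: eq_itg => omega _; apply: eq_itg => x _; rewrite /even_ext H.
Qed.

Hypothesis tp : 0 < t.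

Let dlift : has_deriv (lift phi t) t nu.
Proof. exact: lift_deriv. Qed.

Let lift_shift_pos : \forall s \near t, forall theta omega,
  f (theta + lift phi t s) omega s = f (theta + phi s) omega s.
Proof.
have := lift_shift phi phase t t0 r0; have := near_gt0 t tp.
by apply: filterS2 => s s0 H; apply: H; exact: ltW.
Qed.

Lemma vel_frame omega s : vel t omega (s + phi t) = omega - K * (r * sin s).
Proof. by rewrite (vel_phase t (phi t) _ _ (phase t t0)) addrK. Qed.

Lemma phase_mass_deriv c d : c <= d ->
  has_deriv (fun s => itg (- M) M (fun omega => frame_itg c d (fun=> 1) f (phi s) omega s)) t
   (itg (- M) M (fun omega =>
      (nu - (omega - K * (r * sin d))) * f (d + phi t) omega t
      - (nu - (omega - K * (r * sin c))) * f (c + phi t) omega t)).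
Proof.
move=> cd.
have cW : continuous (fun _ : R => 1 : R) by continuity.
have cW1 : continuous (fun _ : R => 0 : R) by continuity.
have MM0 : 0 <= M by exact: ltW.
have := itg_frame_itg_derive _ _ _ cd cW _ _ _ solution_C1 M MM0 _ _ t tp dlift.
rewrite lift_eq => H.
have {}H : has_deriv (fun s => itg (- M) M (fun omega => frame_itg c d (fun=> 1) f (phi s) omega s)) t
   (itg (- M) M (fun omega => frame_itg c d (fun=> 1) (d_theta f) (phi t) omega t * nu
      + frame_itg c d (fun=> 1) (d_t f) (phi t) omega t)).
  apply: near_eq_is_derive H; apply: filterS lift_shift_pos => s H.
  by apply: eq_itg => omega _; apply: eq_itg => x _; rewrite H.
move: H; congr (has_deriv _ _ _); apply: eq_itg => omega _.
have E := @frame_itg_transport R c d (fun=> 1) cd cW f (d_theta f) (d_t f) solution_C1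
  (vel t omega) (vel1 t) (fun=> 0) (fun=> 0) (phi t) nu omega t tp (vel_continuous t omega)
  (vel1_continuous t) cW1 cW1 (has_deriv_cst 1) (vel_deriv t omega)
  (fun theta => solution_equation theta omega t tp).
rewrite E itg_eqfun0; last by move=> x _; rewrite !mul0r mulr0 addr0.
by rewrite !mul1r !vel_frame addr0.
Qed.

Lemma phase_square_deriv c d omega : c <= d ->
  has_deriv (fun s => frame_itg c d (fun=> 1) square_density (phi s) omega s) t
   ((nu - (omega - K * (r * sin d))) * f (d + phi t) omega t ^+ 2
    - (nu - (omega - K * (r * sin c))) * f (c + phi t) omega t ^+ 2
    + itg c d (fun s => K * (r * cos s) * f (s + phi t) omega t ^+ 2)).
Proof.
move=> cd.
have cW : continuous (fun _ : R => 1 : R) by continuity.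
have cW1 : continuous (fun _ : R => 0 : R) by continuity.
have := frame_itg_derive _ _ _ cd cW _ _ _ solution_square_C1 _ _ t omega tp dlift.
rewrite lift_eq => H.
have cf := solution_slice_continuous t omega t0.
have c1 := vel1_continuous t.
(* The source term for the square: [2 f f_t] contains [v_theta f^2] twice and the divergence
   [(v f^2)_theta] only once, so [(f^2)_t + (v f^2)_theta = - v_theta f^2]. *)
have cr : continuous (fun theta => - (vel1 t theta * f theta omega t ^+ 2)) by continuity.
have eqn theta : d_t f theta omega t * f theta omega t + f theta omega t * d_t f theta omega t =
   - (vel1 t theta * f theta omega t ^+ 2) -
   (vel1 t theta * square_density theta omega t +
    vel t omega theta * (d_theta f theta omega t * f theta omega t
                        + f theta omega t * d_theta f theta omega t)).
  by rewrite (solution_equation theta omega t tp) /square_density; ring.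
have E := @frame_itg_transport R c d (fun=> 1) cd cW _ _ _ solution_square_C1
  (vel t omega) (vel1 t) _ (fun=> 0) (phi t) nu omega t tp (vel_continuous t omega)
  c1 cr cW1 (has_deriv_cst 1) (vel_deriv t omega) eqn.
rewrite {}E in H.
have NE : \forall s \near t, frame_itg c d (fun=> 1) square_density (lift phi t s) omega s =
    frame_itg c d (fun=> 1) square_density (phi s) omega s.
  apply: filterS lift_shift_pos => s Hs.
  by apply: eq_itg => x _; rewrite /square_density Hs.
move: (has_deriv_near _ _ _ _ NE H); congr (has_deriv _ _ _).
rewrite !mul1r !vel_frame; congr (_ + _); apply: eq_itg => s _.
by rewrite !mul0r add0r mul1r (vel1_phase t (phi t) _ (phase t t0)) addrK mulNr opprK.
Qed.

(** Over a whole period the boundary fluxes cancel wherever it starts; the free start [c] allows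
    cutting the circle at an end of the arc. *)
Lemma phase_cos_deriv c omega :
  has_deriv (fun s => frame_itg c (c + 2 * pi) (@cos R) f (phi s) omega s) t
   (itg c (c + 2 * pi) (fun s =>
      - sin s * (omega - K * (r * sin s) - nu) * f (s + phi t) omega t)).
Proof.
have cd : c <= c + 2 * pi by rewrite lerDl ltW.
have cW1 : continuous (fun s : R => - sin s) by continuity.
have c0 : continuous (fun _ : R => 0 : R) by continuity.
have := frame_itg_derive _ _ _ cd (@continuous_cos R) _ _ _ solution_C1 _ _ t omega tp dlift.
rewrite lift_eq => H.
have E := @frame_itg_transport R c (c + 2 * pi) (@cos R) cd (@continuous_cos R) _ _ _ solution_C1
  (vel t omega) (vel1 t) (fun=> 0) (fun s => - sin s) (phi t) nu omega t tp (vel_continuous t omega)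
  (vel1_continuous t) c0 cW1 (fun s => is_derive_cos s) (vel_deriv t omega)
  (fun theta => solution_equation theta omega t tp).
rewrite {}E in H.
have NE : \forall s \near t, frame_itg c (c + 2 * pi) (@cos R) f (lift phi t s) omega s =
    frame_itg c (c + 2 * pi) (@cos R) f (phi s) omega s.
  by apply: filterS lift_shift_pos => s Hs; apply: eq_itg => x _; rewrite Hs.
move: (has_deriv_near _ _ _ _ NE H); congr (has_deriv _ _ _).
have e1 : cos (c + 2 * pi) = cos c :> R by rewrite mulr_natl cosD2pi.
have e2 : f (c + 2 * pi + phi t) omega t = f (c + phi t) omega t.
  by rewrite addrAC solution_periodic.
have e3 : vel t omega (c + 2 * pi + phi t) = vel t omega (c + phi t).
  by rewrite addrAC vel_periodic.
rewrite e1 e2 e3 subrr add0r; apply: eq_itg => s _.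
by rewrite mulr0 addr0 vel_frame.
Qed.

End PhaseFrame.

(** * Concentration around the average phase *)

Section Concentration.
Variables (phi : R -> R) (gamma eps : R).
Hypothesis phase : forall t, 0 <= t -> is_average_phase f t (phi t).
Hypothesis gamma_itv : 0 < gamma < pi / 2.
Hypothesis K0 : 0 < K.
Hypothesis eps_itv : 0 < eps <= 1 / 2.

Let amp t := order_amplitude f t.
Let l := pi / 2 - gamma.

Let l_itv : 0 < l < pi / 2.
Proof. by rewrite /l; case/andP: gamma_itv => ? ?; apply/andP; split; lra. Qed.

Let pi0 : 0 < pi :> R. Proof. exact: pi_gt0. Qed.

Let cos_l : cos l = sin gamma.
Proof. by rewrite /l cosB cos_pihalf sin_pihalf mul0r mul1r add0r. Qed.

Let sin_l : sin l = cos gamma.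
Proof. by rewrite /l sinB cos_pihalf sin_pihalf mul0r mul1r subr0. Qed.

Let cos_gamma_gt0 : 0 < cos gamma.
Proof.
by apply: cos_gt0_pihalf; case/andP: gamma_itv => ? ?; apply/andP; split; lra.
Qed.

Let sin_gamma_gt0 : 0 < sin gamma.
Proof. exact: sin_gt0_pihalf. Qed.

Let cos_arc s : - l <= s <= l -> sin gamma <= cos s.
Proof.
rewrite -cos_l -ler_norml -(cos_norm s) => sl.
case/andP: l_itv => l0 l1.
rewrite le_eqVlt; have [->|ne] := eqVneq (`|s|) l; first by rewrite eqxx.
by rewrite ltr_cos ?in_itv/= ?normr_ge0/=; [rewrite lt_neqAle ne sl orbT|lra..].
Qed.

Definition arc_mass t := itg (- M) M (fun omega =>
  frame_itg (- l) l (fun=> 1) f (phi t) omega t).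

Let one_continuous : continuous (fun _ : R => 1 : R). Proof. by continuity. Qed.

Let frame_continuous a b (W : R -> R) x t : a <= b -> continuous W -> 0 <= t ->
  continuous (fun omega => frame_itg a b W f x omega t).
Proof.
move=> ab cW t0 omega.
have := continuous_at_curry3 (frame_itg a b W even_ext) (fun=> x) (fun w => w) (fun=> t) omega
  (even_frame_continuous a b W omega x t ab cW).
move=> H; have {}H := H ltac:(continuity) ltac:(continuity) ltac:(continuity).
by move: H; rewrite /frame_itg /even_ext (ger0_norm t0).
Qed.

Let frame_slice_continuous (W : R -> R) x omega t : continuous W -> 0 <= t ->
  continuous (fun s => W s * f (s + x) omega t).
Proof.
move=> cW t0 s; apply: continuous_atM; first exact: cW.
apply: (continuous_at_comp (fun s => s + x) (fun s => f s omega t)); first by continuity.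
exact: solution_slice_continuous.
Qed.

Let arc_le : - l <= l. Proof. by case/andP: l_itv => ? ?; lra. Qed.

(** [1 + R] is the mean of [1 + cos (theta - phi)], which is nonnegative everywhere and at least
    [1 + sin gamma] on the arc. *)
Lemma amplitude_ge_mass t : 0 <= t -> (1 + sin gamma) * arc_mass t <= 1 + amp t.
Proof.
move=> t0; have phx := phase t t0.
have -> : 1 + amp t = expect t (fun _ theta => 1 + cos (theta - phi t)).
  rewrite (expectD t (fun _ _ => 1) _ t0); [|by continuity|by continuity].
  by rewrite (expect_cst t _ t0) (expect_cos_phase t _ t0 phx).
have cW : continuous (fun s : R => 1 + cos s) by continuity.
(* By periodicity the circle is cut at the left end of the arc, which becomes an initial segment of
   the period. *)
have -> : expect t (fun _ theta => 1 + cos (theta - phi t)) =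
    itg (- M) M (fun omega => frame_itg (- l) (- l + 2 * pi) (fun s => 1 + cos s) f (phi t) omega t).
  apply: eq_itg => omega _; rewrite /frame_itg.
  pose F theta := (1 + cos (theta - phi t)) * f theta omega t.
  have cF : continuous F.
    by have cf := solution_slice_continuous t omega t0; rewrite /F; continuity.
  have FT y : F (y + 2 * pi) = F y.
    by rewrite /F solution_periodic// addrAC mulr_natl cosD2pi.
  have := @itg_shift R (- l) (- l + 2 * pi) (phi t) F.
  rewrite lerDl (ltW twopi_gt0) => /(_ isT cF).
  rewrite -addrA [2 * pi + _]addrC addrA.
  rewrite (@itg_periodic R F (2 * pi) (- l + phi t) 0 twopi_gt0 cF FT) add0r => <-.
  by apply: eq_itg => s _; rewrite /F addrK.
have lpi : - l <= l <= - l + 2 * pi by case/andP: l_itv => ? ?; apply/andP; split; lra.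
have lpi' : - l <= - l + 2 * pi by rewrite lerDl ltW.
rewrite /arc_mass -itgZ; last exact: frame_continuous.
apply: le_itg.
- by move=> omega; apply: continuous_atM; [continuity|exact: frame_continuous].
- exact: frame_continuous.
move=> omega _; rewrite /frame_itg.
have c1 := frame_slice_continuous _ (phi t) omega t cW t0.
have c2 := frame_slice_continuous _ (phi t) omega t one_continuous t0.
rewrite (itg_chasles _ _ _ _ c1 lpi) -itgZ// -[leLHS]addr0; apply: lerD.
  apply: le_itg => //; first by move=> s; apply: continuous_atM; [continuity|exact: c2].
  move=> s sl; rewrite mul1r; apply: ler_wpM2r; first exact: (KS_ge0 KS).
  by rewrite lerD2l; exact: cos_arc.
apply: itg_ge0 => s _; apply: mulr_ge0; last exact: (KS_ge0 KS).
by have := cos_geN1 s; lra.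
Qed.

(** Since [1 + cos gamma <= 2], the amplitude is at least 1/2, hence at least [eps]; this is what
    turns [M / R] into [M / eps]. *)
Lemma amplitude_lower t e : 0 <= e -> 1 + e <= amp t * (1 + cos gamma) -> eps <= amp t.
Proof.
move=> e0 he; have c1 : cos gamma <= 1 by exact: cos_le1.
by case/andP: eps_itv => ? ?; have := cos_gamma_gt0; nra.
Qed.

(* The ends of the arc are [+- l] in the frame of the average phase and [sin l = cos gamma],
   so the gap controls the sign of the fluxes there. *)
Lemma speed_gap t e omega : 0 <= t -> 0 <= e -> 1 + e <= amp t * (1 + cos gamma) ->
  - M <= omega <= M ->
  `|omega - phase_speed t (phi t)| <=
  K * (amp t * cos gamma) - (K * e - M - M / eps).
Proof.
move=> t0 e0 he oM; have r1 := amplitude_lower t e e0 he.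
case/andP: eps_itv => eps0 _.
have r0 : 0 < amp t by exact: lt_le_trans r1.
have := phase_speed_bound t (phi t) t0 (phase t t0) (ltW K0) r0.
rewrite -/(amp t) => nub.
apply: (le_trans (ler_normB _ _)).
have oM' : `|omega| <= M by rewrite ler_norml.
have Mr : M / amp t <= M / eps by rewrite ler_pM2l// lef_pV2 ?posrE.
(* Times [K], the hypothesis reads [K (1 - R) <= K R cos gamma - K e], which absorbs the last term
   of [phase_speed_bound]. *)
have := ler_wpM2l (ltW K0) he; lra.
Qed.

(** A general [e] serves two purposes: the bootstrap takes the one with [K * e = M + M / eps], the
    final monotonicity takes [eps]. *)
Lemma arc_mass_deriv_ge0 t e : 0 < t -> 0 <= e -> M + M / eps <= K * e ->
  1 + e <= amp t * (1 + cos gamma) ->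
  exists2 d, has_deriv arc_mass t d & 0 <= d.
Proof.
move=> tp e0 Ke he; have t0 := ltW tp.
have r0 : 0 < amp t.
  by apply: lt_le_trans (amplitude_lower t e e0 he); case/andP: eps_itv.
exists (itg (- M) M (fun omega =>
   (phase_speed t (phi t) - (omega - K * (amp t * sin l))) * f (l + phi t) omega t
   - (phase_speed t (phi t) - (omega - K * (amp t * sin (- l)))) * f (- l + phi t) omega t)).
  exact: phase_mass_deriv.
apply: itg_ge0 => omega oM; have := speed_gap t e omega t0 e0 he oM.
rewrite ler_norml sinN sin_l => /andP[g1 g2].
have f1 : 0 <= f (l + phi t) omega t by exact: (KS_ge0 KS).
have f2 : 0 <= f (- l + phi t) omega t by exact: (KS_ge0 KS).
by apply: subr_mulr_ge0 => //; lra.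
Qed.

Hypothesis K_large : M / eps * (1 + 1 / eps) < K.
Hypothesis mass0 : Mstar eps gamma <= arc_mass 0.

(** Its positivity is the condition [K_large] multiplied by [eps]. *)
Let gap := K * eps - M - M / eps.

Let gap_gt0 : 0 < gap.
Proof.
case/andP: eps_itv => e0 _; rewrite /gap.
have : eps * (M / eps * (1 + 1 / eps)) < eps * K by rewrite ltr_pM2l.
have -> : eps * (M / eps * (1 + 1 / eps)) = M + M / eps by field; rewrite gt_eqF.
by lra.
Qed.

(** The origin of the threshold: [(1 + sin gamma) * Mstar eps gamma] equals
    [1 + (1 + eps) / (1 + cos gamma)], to be compared with [1 + R]. *)
Lemma amplitude_of_mass t : 0 <= t -> Mstar eps gamma <= arc_mass t ->
  1 + eps <= amp t * (1 + cos gamma).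
Proof.
move=> t0 mt; have sg := sin_gamma_gt0; have cg := cos_gamma_gt0.
have := amplitude_ge_mass t t0.
have : (1 + sin gamma) * Mstar eps gamma <= (1 + sin gamma) * arc_mass t.
  by rewrite ler_pM2l//; lra.
have -> : (1 + sin gamma) * Mstar eps gamma = (2 + eps + cos gamma) / (1 + cos gamma).
  by rewrite /Mstar; field; rewrite !gt_eqF//; lra.
move=> h1 h2; have := le_trans h1 h2.
rewrite ler_pdivrMr; lra.
Qed.

Lemma amplitude_bootstrap t : 0 <= t -> 1 + eps <= amp t * (1 + cos gamma).
Proof.
case/andP: eps_itv => eps0 _.
(* The least [e] for which the fluxes point inwards. It is below [eps] because [gap] is positive,
   and this leaves the room between [1 + e] and [1 + eps] that the bootstrap needs. *)
pose e := (M + M / eps) / K.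
have e0 : 0 <= e by rewrite divr_ge0 ?addr_ge0 ?divr_ge0// ltW.
have Ke : M + M / eps <= K * e by rewrite /e mulrCA divff ?mulr1// gt_eqF.
have ee : e < eps.
  by rewrite /e ltr_pdivrMr//; have := gap_gt0; rewrite /gap; lra.
apply: (@continuity_bootstrap R (fun t => amp t * (1 + cos gamma)) _ (1 + e)).
- by rewrite ltrD2l.
- exact: amplitude_of_mass.
- have ca := even_amplitude_continuous.
  by move=> s; apply: continuous_atM; [exact: ca|continuity].
(* While the weaker bound holds the arc loses no mass, so the initial threshold is still met at time
   [s]. *)
- move=> s s0 Hs; apply: amplitude_of_mass => //; apply: le_trans mass0 _.
  rewrite -subr_ge0.
  have Hr u : 0 <= u <= s -> 0 < amp u.
    move=> us; apply: lt_le_trans (amplitude_lower u e e0 (ltW (Hs u us))); exact: eps0.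
  apply: (le_trans _ (@linear_growth R arc_mass 0 0 s _ _ _)); first by rewrite mul0r.
  + by rewrite lexx.
  + move=> u us; apply: phase_itg_frame_continuous => //; first by case/andP: us.
    exact: Hr.
  + move=> u /andP[u0 us]; apply: (arc_mass_deriv_ge0 u e) => //.
    by apply/ltW/Hs; rewrite !ltW.
Qed.

Let amp_gt0 t : 0 <= t -> 0 < amp t.
Proof.
move=> t0; have eps0 : 0 < eps by case/andP: eps_itv.
apply: (lt_le_trans eps0); exact: amplitude_lower (ltW eps0) (amplitude_bootstrap t t0).
Qed.

Let amp_ge t : 0 <= t -> eps <= amp t.
Proof.
move=> t0; have eps0 : 0 < eps by case/andP: eps_itv.
exact: amplitude_lower (ltW eps0) (amplitude_bootstrap t t0).
Qed.

Let gap_bound t omega : 0 <= t -> - M <= omega <= M ->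
  `|omega - phase_speed t (phi t)| <= K * (amp t * cos gamma) - gap.
Proof.
move=> t0; case/andP: (eps_itv) => eps0 _.
by apply: speed_gap => //; [exact: ltW|exact: amplitude_bootstrap].
Qed.

Lemma arc_mass_nondecreasing t : 0 < t -> exists2 d, has_deriv arc_mass t d & 0 <= d.
Proof.
move=> t0; case/andP: (eps_itv) => eps0 _.
apply: (arc_mass_deriv_ge0 t eps) => //; first exact: ltW.
- by have := gap_gt0; rewrite /gap; lra.
- by apply: amplitude_bootstrap; exact: ltW.
Qed.

(** * Square integrals at a fixed frequency *)

Section FixedFrequency.
Variable omega : R.
Hypothesis oM : - M <= omega <= M.

Definition arc_square a b t := frame_itg a b (fun=> 1) square_density (phi t) omega t.

(** A lower bound for the source coefficient [K R cos s] on the arc, uniform in time and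
    frequency. *)
Definition growth_rate := K * (eps * sin gamma).

Lemma arc_square_growth a b : 0 <= a <= b ->
  arc_square (- l) l a * expR (growth_rate * (b - a)) <= arc_square (- l) l b.
Proof.
move=> ab; apply: exponential_growth => // t t0.
  by apply: phase_square_continuous => //; exact: amp_gt0.
eexists; first by apply: phase_square_deriv => //; [exact: ltW|apply: amp_gt0; exact: ltW].
have {}t0 := ltW t0.
have := gap_bound t omega t0 oM; have g0 := gap_gt0.
rewrite ler_norml sinN sin_l => /andP[g1 g2].
have cf := frame_slice_continuous _ (phi t) omega t one_continuous t0.
have c1 : continuous (fun s => f (s + phi t) omega t).
  by move=> s; have := cf s; under eq_fun do rewrite mul1r.
have c2 : continuous (fun s => 1 * square_density (s + phi t) omega t).
  by rewrite /square_density; continuity.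
rewrite -[leLHS]add0r; apply: lerD.
  by apply: subr_mulr_ge0; rewrite ?sqr_ge0// /amp in g1 g2 *; lra.
rewrite /arc_square /frame_itg -itgZ//; apply: le_itg.
- by move=> s; apply: continuous_atM; [continuity|exact: c2].
- by continuity.
move=> s sl; rewrite mul1r /square_density; apply: ler_wpM2r; first exact: sqr_ge0.
rewrite /growth_rate ler_pM2l//; apply: ler_pM => //.
- by case/andP: eps_itv => /ltW.
- exact: ltW.
- exact: amp_ge.
- exact: cos_arc.
Qed.

Lemma antiarc_square_decay t : 0 <= t ->
  arc_square (pi - l) (pi + l) t <=
  arc_square (pi - l) (pi + l) 0 * expR (- growth_rate * t).
Proof.
move=> t0.
have ab : pi - l <= pi + l by rewrite lerD2l.
(* Decay is read as growth of the negated integral at a negative rate. *)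
rewrite -lerN2 -mulNr -[in X in _ * X](subr0 t).
apply: (@exponential_growth R (fun t => - arc_square (pi - l) (pi + l) t)).
- by rewrite lexx.
- move=> s s0; apply: continuous_atN; apply: phase_square_continuous => //; exact: amp_gt0.
move=> {t0} {}t t0.
eexists; first by apply: has_derivN; apply: phase_square_deriv => //;
  [exact: ltW|apply: amp_gt0; exact: ltW].
have {}t0 := ltW t0.
have := gap_bound t omega t0 oM; have g0 := gap_gt0.
rewrite ler_norml => /andP[g1 g2].
have s1 : sin (pi + l) = - cos gamma by rewrite addrC sinDpi sin_l.
have s2 : sin (pi - l) = cos gamma by rewrite sinB sinpi cospi sin_l; ring.
have cf := frame_slice_continuous _ (phi t) omega t one_continuous t0.
have c1 : continuous (fun s => f (s + phi t) omega t).
  by move=> s; have := cf s; under eq_fun do rewrite mul1r.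
have c2 : continuous (fun s => 1 * square_density (s + phi t) omega t).
  by rewrite /square_density; continuity.
(* At the ends of the antipodal arc the sine has the opposite sign, so both fluxes point out of
   it. *)
have F1 : (phase_speed t (phi t) - (omega - K * (amp t * sin (pi + l)))) *
     f (pi + l + phi t) omega t ^+ 2 -
   (phase_speed t (phi t) - (omega - K * (amp t * sin (pi - l)))) *
     f (pi - l + phi t) omega t ^+ 2 <= 0.
  rewrite -oppr_ge0 opprB s1 s2; apply: subr_mulr_ge0; rewrite ?sqr_ge0//; lra.
have F2 : itg (pi - l) (pi + l) (fun s => K * (amp t * cos s) * f (s + phi t) omega t ^+ 2)
    <= - (growth_rate * arc_square (pi - l) (pi + l) t).
  rewrite /arc_square /frame_itg -mulNr -itgZ//; apply: le_itg.
  - by continuity.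
  - by move=> s; apply: continuous_atM; [continuity|exact: c2].
  move=> s sl; rewrite mul1r /square_density; apply: ler_wpM2r; first exact: sqr_ge0.
  have cs : sin gamma <= - cos s.
    have -> : - cos s = cos (s - pi) by rewrite cosB cospi sinpi; ring.
    by apply: cos_arc; case/andP: sl => h1 h2; apply/andP; split; lra.
  rewrite /growth_rate -mulrN ler_pM2l// lerNr -mulrN; apply: ler_pM => //.
  - by case/andP: eps_itv => /ltW.
  - exact: ltW.
  - exact: amp_ge.
rewrite -/(amp t) mulrNN lerNr; apply: (le_trans (lerD F1 F2)).
by rewrite add0r.
Qed.

Lemma arc_square_eq0_vanish : (forall t, 0 <= t -> arc_square (- l) l t = 0) ->
  forall t s, 0 <= t -> - l <= s <= l -> f (s + phi t) omega t = 0.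
Proof.
move=> H t s t0 sl.
have cf := frame_slice_continuous _ (phi t) omega t one_continuous t0.
have c1 : continuous (fun s => f (s + phi t) omega t).
  by move=> u; have := cf u; under eq_fun do rewrite mul1r.
have c2 : continuous (fun s => 1 * square_density (s + phi t) omega t).
  by rewrite /square_density; continuity.
have l2 : - l < l by case/andP: l_itv; lra.
have := @itg_eq0P R (- l) l _ c2 l2 _ (H t t0) s sl.
rewrite mul1r /square_density => H1; apply/eqP; rewrite -sqrf_eq0; apply/eqP/H1.
by move=> u _; rewrite mul1r sqr_ge0.
Qed.

Lemma marginal_frame x t a : 0 <= t ->
  itg a (a + 2 * pi) (fun s => f (s + x) omega t) = g omega.
Proof.
move=> t0; have cf := solution_slice_continuous t omega t0.
rewrite (itg_shift a (a + 2 * pi) x (fun s => f s omega t))//; last by rewrite lerDl ltW.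
rewrite addrAC (itg_periodic (fun s => f s omega t) (2 * pi) (a + x) 0 twopi_gt0 cf).
  by rewrite add0r marginal.
by move=> y; exact: solution_periodic.
Qed.

Let sin_middle s : l <= s <= pi - l -> cos gamma <= sin s.
Proof.
move=> sl; have -> : sin s = cos (s - pi / 2) by rewrite cosBpihalf.
rewrite -(cos_norm (s - pi / 2)).
have sg : `|s - pi / 2| <= gamma.
  by rewrite ler_norml; move: sl => /andP[]; rewrite /l => ? ?; apply/andP; split; lra.
case/andP: gamma_itv => g0 g1.
rewrite le_eqVlt; have [->|ne] := eqVneq (`|s - pi / 2|) gamma; first by rewrite eqxx.
by rewrite ltr_cos ?in_itv/= ?normr_ge0/=; [rewrite lt_neqAle ne sg orbT|lra..].
Qed.

(* If the arc never meets the support, the antipodal arc carries exponentially little mass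
   while everything else is pushed towards [phi] at a uniform rate, so that
   [int cos (theta - phi) f dtheta] would grow without bound. *)
Lemma arc_square_eventually_gt0 : 0 < g omega ->
  exists2 t, 0 <= t & 0 < arc_square (- l) l t.
Proof.
move=> gp; apply/not_exists2P => Hne.
have f_ge0 s t : 0 <= t -> 0 <= f (s + phi t) omega t.
  by move=> t0; exact: (KS_ge0 KS).
have Hz t : 0 <= t -> arc_square (- l) l t = 0.
  move=> t0; apply/eqP; rewrite eq_le; apply/andP; split.
    by rewrite leNgt; apply/negP => h; case: (Hne t).
  by apply: itg_ge0 => s _; rewrite mul1r /square_density sqr_ge0.
have f0l := arc_square_eq0_vanish Hz.
have kap0 : 0 < cos gamma * gap by rewrite mulr_gt0.
set kap := cos gamma * gap in kap0 *.
(* The largest possible deficit of [P] below [kap], since [P] is at least [- K] everywhere. *)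
pose K' := kap + K.
have K'0 : 0 < K' by rewrite addr_gt0.
have amp1 t : 0 <= t -> amp t <= 1.
  move=> t0; rewrite /amp -(expect_cos_phase t (phi t) t0 (phase t t0)) -(expect_cst t 1 t0).
  by apply: (le_expect t _ _ t0); [continuity|continuity|move=> *; exact: cos_le1].
have [l0 l1] := andP l_itv.
(* The integrand of the derivative of [A] below, per unit of [f]. Where [|sin s| >= cos gamma], the
   attraction [K R |sin s|] beats the relative speed by [gap], and the outer factor [sin s]
   contributes [cos gamma]; hence [kap]. *)
pose P t s := - sin s * (omega - K * (amp t * sin s) - phase_speed t (phi t)).
have Pmid t s : 0 <= t -> cos gamma <= `|sin s| -> kap <= P t s.
  move=> t0 cs; have := gap_bound t omega t0 oM.
  set d := omega - phase_speed t (phi t) => dg.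
  have -> : P t s = K * amp t * `|sin s| * `|sin s| - sin s * d.
    by rewrite /P /d -mulrA -expr2 real_normK ?num_real//; ring.
  have h1 : sin s * d <= `|sin s| * `|d| by rewrite -normrM ler_norm.
  have a0 : 0 <= K * amp t by rewrite mulr_ge0 ?ltW// amp_gt0.
  have h2 : K * (amp t * cos gamma) <= K * amp t * `|sin s|.
    by rewrite mulrA ler_wpM2l.
  have h3 : gap <= K * amp t * `|sin s| - `|d| by lra.
  have h4 : cos gamma * gap <= `|sin s| * (K * amp t * `|sin s| - `|d|).
    by apply: ler_pM => //; exact: ltW.
  by rewrite /kap; move: h4 h1; rewrite mulrBr; lra.
have Panti t s : 0 <= t -> - K <= P t s.
  move=> t0; have := gap_bound t omega t0 oM; have g0 := gap_gt0.
  set d := omega - phase_speed t (phi t) => dg.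
  have -> : P t s = K * amp t * (sin s) ^+ 2 - sin s * d by rewrite /P /d; ring.
  have a0 : 0 <= K * amp t by rewrite mulr_ge0 ?ltW// amp_gt0.
  have h0 : 0 <= K * amp t * sin s ^+ 2 by rewrite mulr_ge0// sqr_ge0.
  have h1 : sin s * d <= `|d|.
    by apply: (le_trans (ler_norm _)); rewrite normrM ler_piMl// sin_max.
  have h2 : K * (amp t * cos gamma) <= K.
    rewrite -[leRHS]mulr1 ler_pM2l// mulr_ile1 ?amp1//.
    - exact/ltW/amp_gt0.
    - exact: ltW.
  lra.
pose H0 := arc_square (pi - l) (pi + l) 0.
have H00 : 0 <= H0 by apply: itg_ge0 => s _; rewrite mul1r /square_density sqr_ge0.
(* Chosen so that [K' * eta * (2 * l)] is [kap * g omega / 4], half of the error allowed on the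
   antipodal arc. *)
pose eta := kap * g omega / (8 * l * K').
have eta0 : 0 < eta by rewrite divr_gt0 ?mulr_gt0.
pose m t := itg (pi - l) (pi + l) (fun s => f (s + phi t) omega t).
have c1 t : 0 <= t -> continuous (fun s => f (s + phi t) omega t).
  move=> t0 u; have := frame_slice_continuous _ (phi t) omega t one_continuous t0 u.
  by under eq_fun do rewrite mul1r.
have ab : pi - l <= pi + l by rewrite lerD2l.
(* The inequality [y <= eta + y ^ 2 / (4 eta)] converts decay of the square integral into smallness
   of the mass. *)
have m_le t : 0 <= t -> m t <= eta * (2 * l) + (4 * eta)^-1 * arc_square (pi - l) (pi + l) t.
  move=> t0; have ct1 := c1 t t0.
  have -> : eta * (2 * l) = itg (pi - l) (pi + l) (fun=> eta).
    by rewrite itg_cst//; ring.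
  have c2 : continuous (fun s => 1 * square_density (s + phi t) omega t).
    by rewrite /square_density; continuity.
  have c3 : continuous (fun s => (4 * eta)^-1 * (1 * square_density (s + phi t) omega t)).
    by move=> s; apply: continuous_atM; [continuity|exact: c2].
  have c4 : continuous (fun _ : R => eta) by continuity.
  rewrite /arc_square /frame_itg -itgZ// -itgD//; apply: le_itg => //.
    by move=> s; apply: continuous_atD; [continuity|exact: c3].
  move=> s _; rewrite mul1r /square_density; set y := f _ _ _.
  rewrite -subr_ge0.
  have -> : eta + (4 * eta)^-1 * y ^+ 2 - y = (4 * eta)^-1 * (2 * eta - y) ^+ 2.
    by field; rewrite gt_eqF.
  by rewrite mulr_ge0 ?sqr_ge0// invr_ge0 mulr_ge0// ltW.
pose C := growth_rate.
have C0 : 0 < C by rewrite /C /growth_rate !mulr_gt0//; case/andP: eps_itv.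
(* After [T1] the square term also costs at most [kap * g omega / 4]; the bound
   [1 + C t <= expR (C * t)] makes this time explicit without a logarithm. *)
pose T1 := K' * H0 / (kap * g omega * eta) / C.
have kge : 0 < kap * g omega * eta by exact: mulr_gt0 (mulr_gt0 kap0 gp) eta0.
have T10 : 0 <= T1.
  by apply: divr_ge0 (ltW C0); apply: divr_ge0 (ltW kge); apply: mulr_ge0 (ltW K'0) H00.
have small t : T1 <= t -> K' * m t <= kap * g omega / 2.
  move=> T1t; have t0 := le_trans T10 T1t.
  have h1 := m_le t t0; have h2 := antiarc_square_decay t t0.
  rewrite -/H0 -/C in h2.
  have e1 : 1 + C * t <= expR (C * t) by exact: expR_ge1Dx.
  have e2 : expR (- C * t) * expR (C * t) = 1 by rewrite -expRD mulNr addNr expR0.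
  have e3 := expR_gt0 (- C * t).
  have h3 : K' * H0 / (kap * g omega * eta) <= C * t.
    by rewrite [C * t]mulrC -ler_pdivrMr.
  have h4 : K' * H0 <= kap * g omega * eta * expR (C * t).
    rewrite ler_pdivrMr// in h3; apply: (le_trans h3).
    by rewrite [C * t * _]mulrC ler_pM2l//; lra.
  have h5 : K' * (H0 * expR (- C * t)) <= kap * g omega * eta.
    have h := ler_wpM2r (ltW e3) h4; rewrite mulrA; apply: (le_trans h).
    set X := kap * g omega * eta in h h4 kge *.
    by rewrite -(mulrA X) [expR (C * t) * _]mulrC e2 mulr1.
  have h6 : K' * arc_square (pi - l) (pi + l) t <= kap * g omega * eta.
    by apply: le_trans h5; rewrite ler_pM2l.
  have i4 : 0 < (4 * eta)^-1 by rewrite invr_gt0 mulr_gt0.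
  have h7 : (4 * eta)^-1 * (K' * arc_square (pi - l) (pi + l) t) <= kap * g omega / 4.
    apply: (le_trans (ler_wpM2l (ltW i4) h6)).
    by rewrite le_eqVlt; apply/orP; left; apply/eqP; field; rewrite gt_eqF.
  have h8 : K' * (eta * (2 * l)) = kap * g omega / 4.
    by rewrite /eta; field; rewrite !gt_eqF.
  apply: (le_trans (ler_wpM2l (ltW K'0) h1)).
  rewrite mulrDr h8 mulrCA; lra.
pose A t := frame_itg (- l) (- l + 2 * pi) (@cos R) f (phi t) omega t.
have lpi : - l <= - l + 2 * pi by rewrite lerDl ltW.
have A_bound t : 0 <= t -> - g omega <= A t <= g omega.
  move=> t0; have ct1 := c1 t t0.
  have ccf : continuous (fun s => cos s * f (s + phi t) omega t) by continuity.
  rewrite -(marginal_frame (phi t) t (- l) t0); apply/andP; split.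
    rewrite -mulN1r -itgZ//; apply: le_itg => //; first by continuity.
    by move=> s _; apply: ler_wpM2r; [exact: f_ge0|exact: cos_geN1].
  apply: le_itg => // s _; rewrite -[leRHS]mul1r.
  by apply: ler_wpM2r; [exact: f_ge0|exact: cos_le1].
have A_deriv t : 0 < t -> has_deriv A t
    (itg (- l) (- l + 2 * pi) (fun s => P t s * f (s + phi t) omega t)).
  by move=> tp; apply: phase_cos_deriv => //; [exact: ltW|apply: amp_gt0; exact: ltW].
have A_lower t : 0 <= t -> T1 <= t -> kap * g omega / 2 <=
    itg (- l) (- l + 2 * pi) (fun s => P t s * f (s + phi t) omega t).
  move=> t0 T1t; have ct1 := c1 t t0.
  have cP : continuous (fun s => P t s * f (s + phi t) omega t) by rewrite /P; continuity.
  have ck : continuous (fun s => kap * f (s + phi t) omega t) by continuity.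
  (* Subtracting [kap * f], whose integral is [kap * g omega], leaves an integrand that vanishes on
     the arc, is nonnegative between the two arcs, and is at least [- K' * f] on the antipodal
     one. *)
  suff : - (K' * m t) <= itg (- l) (- l + 2 * pi) (fun s =>
      P t s * f (s + phi t) omega t - kap * f (s + phi t) omega t).
    rewrite itgB// itgZ// marginal_frame//; have := small t T1t; lra.
  have cD : continuous (fun s => P t s * f (s + phi t) omega t - kap * f (s + phi t) omega t).
    by move=> s; apply: continuous_atD; [exact: cP|apply: continuous_atN; exact: ck].
  rewrite (itg_chasles (- l) (pi - l) _ _ cD); last by apply/andP; split; lra.
  rewrite (itg_chasles (pi - l) (pi + l) _ _ cD); last by apply/andP; split; lra.
  rewrite -[leLHS]add0r; apply: lerD.
    apply: itg_ge0 => s /andP[s1 s2]; have [sl|sl] := leP s l.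
      by rewrite (f0l t s t0) ?s1// !mulr0 subrr.
    rewrite -mulrBl mulr_ge0 ?f_ge0// subr_ge0 Pmid//.
    by apply: le_trans (ler_norm _); apply: sin_middle; rewrite (ltW sl).
  rewrite -[leLHS]addr0; apply: lerD.
    rewrite /m -mulNr -itgZ//; apply: le_itg => //; first by continuity.
    move=> s _; rewrite -mulrBl; apply: ler_wpM2r; first exact: f_ge0.
    by have := Panti t s t0; rewrite /K'; lra.
  apply: itg_ge0 => s /andP[s1 s2].
  rewrite -mulrBl mulr_ge0 ?f_ge0// subr_ge0 Pmid//.
  have -> : sin s = - sin (s - pi) by rewrite sinB cospi sinpi; ring.
  by rewrite normrN; apply: le_trans (ler_norm _); apply: sin_middle; apply/andP; split; lra.
(* At rate [kap * g omega / 2], the duration [8 / kap] yields an increase of [4 * g omega], while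
   [A] can vary by at most [2 * g omega]. *)
pose T2 := T1 + 8 / kap.
have k8 : 0 < 8 / kap by rewrite divr_gt0.
have T12 : 0 <= T1 <= T2 by rewrite T10/= lerDl ltW.
have := @linear_growth R A (kap * g omega / 2) T1 T2 T12.
have -> : kap * g omega / 2 * (T2 - T1) = 4 * g omega.
  by rewrite /T2; field; rewrite gt_eqF.
move=> LG.
have b1 := A_bound T1 T10; have b2 := A_bound T2 (le_trans T10 (proj2 (andP T12))).
suff : 4 * g omega <= A T2 - A T1.
  by move: b1 b2 => /andP[b1 b1'] /andP[b2 b2'] b3; lra.
apply: LG => t /andP[t1 t2].
  have t0 := le_trans T10 t1.
  by apply: phase_frame_continuous => //; [exact: amp_gt0|exact: continuous_cos].
have t0 := le_lt_trans T10 t1.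
by eexists; [exact: A_deriv|apply: A_lower; exact: ltW].
Qed.

Lemma arc_L2_growth : 0 < g omega ->
  L2_growth f (fun t => circle_arc (phi t) l) growth_rate omega.
Proof.
move=> gp; have l0 : 0 < l by case/andP: l_itv.
have E t : 0 <= t -> L2_mass f (circle_arc (phi t) l) omega t = arc_square (- l) l t.
  by move=> t0; rewrite L2_mass_arc_itg.
have from T : 0 <= T -> 0 < arc_square (- l) l T ->
    forall t, T <= t -> arc_square (- l) l T * expR (- (growth_rate * T)) *
      expR (growth_rate * t) <= L2_mass f (circle_arc (phi t) l) omega t.
  move=> T0 pT t Tt; rewrite E; last exact: le_trans T0 Tt.
  have T0t : 0 <= T <= t by rewrite T0.
  apply: le_trans (arc_square_growth T t T0t).
  by rewrite -mulrA -expRD mulrBr addrC.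
(* The waiting time must be 0 as soon as the initial square integral on the arc is positive; only
   otherwise is a later time taken. *)
have [p0|n0] := boolP (0 < arc_square (- l) l 0).
  exists (arc_square (- l) l 0 * expR (- (growth_rate * 0))), 0; split => //.
    by rewrite mulr_gt0// expR_gt0.
  exact: from.
have [T T0 pT] := arc_square_eventually_gt0 gp.
exists (arc_square (- l) l T * expR (- (growth_rate * T))), T; split => //.
- by rewrite mulr_gt0// expR_gt0.
- by rewrite E// (negbTE n0).
- exact: from.
Qed.

End FixedFrequency.

Lemma arc_concentration :
  (forall t, 0 < t -> derivable (fun s => mass f (circle_arc (phi s) l) s) t 1 /\
     0 <= (fun s => mass f (circle_arc (phi s) l) s)^`()%classic t) /\
  exists2 C : R, 0 < C & forall omega, g omega != 0 ->
    L2_growth f (fun t => circle_arc (phi t) l) C omega.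
Proof.
have l0 : 0 < l by case/andP: l_itv.
split.
  move=> t t0; have [d dd d0] := arc_mass_nondecreasing t t0.
  have H : has_deriv (fun s => mass f (circle_arc (phi s) l) s) t d.
    apply: has_deriv_near dd; have := near_gt0 t t0; apply: filterS => s s0.
    by rewrite (mass_arc_itg _ _ _ (ltW s0) l0).
  by have [H1 ->] := has_deriv_derive1 _ _ _ H.
exists growth_rate; first by rewrite /growth_rate !mulr_gt0//; case/andP: eps_itv.
move=> omega g0.
have oM : - M <= omega <= M.
  have /suppg : supp g omega by apply: subset_closure.
  by rewrite /= in_itv/= => /andP[/ltW -> /ltW ->].
apply: arc_L2_growth oM _.
rewrite lt_neqAle eq_sym g0/= -(marginal omega 0)//.
by apply: itg_ge0 => s _; exact: (KS_ge0 KS).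
Qed.
End Concentration.
End Solution.

Theorem theorem3p2 (R : realType) (M K eps0 gamma0 : R)
    (g : R -> R) (f0 : R -> R -> R) (f : R -> R -> R -> R) (phi : R -> R) :
  0 < M -> 0 < K ->
  frequency_density g ->
  supp g `<=` `]- M, M[ ->
  0 < eps0 < 3 * Num.sqrt 3 / 4 - 1 ->
  M / eps0 * (1 + 1 / eps0) < K ->
  (forall theta omega, omega \notin `[- M, M] -> f0 theta omega = 0) ->
  Linfty_bounded f0 ->
  pi / 3 <= gamma0 < asin (1 - 2 * eps0 / (2 * Num.sqrt 3 + 1)) ->
  KS_C1_solution K g f0 f ->
  (forall t, 0 <= t -> is_average_phase f t (phi t)) ->
  Mstar eps0 gamma0 <= initial_mass f0 (Lplus gamma0 (phi 0)) ->
  exists2 l : R, 0 < l < pi &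
    let L t := circle_arc (phi t) l in
    (forall t, 0 < t ->
       derivable (fun s => mass f (L s) s) t 1 /\
       0 <= (fun s => mass f (L s) s)^`()%classic t) /\
    exists2 C : R, 0 < C &
      forall omega, g omega != 0 -> L2_growth f L C omega.
Proof.
move=> M0 K0 _ suppg /andP[eps_gt0 eps_lt] K_large _ _ /andP[gamma_ge gamma_lt] KS phase mass0.
have pi0 : 0 < pi :> R by exact: pi_gt0.
have s0 : 0 <= Num.sqrt 3 :> R by exact: sqrtr_ge0.
have s2 : Num.sqrt 3 ^+ 2 = 3 :> R by rewrite sqr_sqrtr.
(* With [Num.sqrt 3 < 2] the upper bound on [eps0] is below 1/2, the value required for
   [amplitude_lower]. *)
have s_lt2 : Num.sqrt 3 < 2 :> R by rewrite ltNge; apply/negP => ?; nra.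
have eps_itv : 0 < eps0 <= 1 / 2 by rewrite eps_gt0/=; lra.
have gamma_itv : 0 < gamma0 < pi / 2.
  apply/andP; split; first by apply: lt_le_trans gamma_ge; rewrite divr_gt0.
  apply: (lt_le_trans gamma_lt); apply: asin_lepi2.
  have q0 : 0 <= 2 * eps0 / (2 * Num.sqrt 3 + 1).
    by rewrite divr_ge0//; lra.
  have q1 : 2 * eps0 / (2 * Num.sqrt 3 + 1) <= 2.
    by rewrite ler_pdivrMr; lra.
  by apply/andP; split; lra.
exists (pi / 2 - gamma0); first by case/andP: gamma_itv => ? ?; apply/andP; split; lra.
apply: (arc_concentration K M g f0 f KS M0 suppg phi gamma0 eps0 phase) => //.
apply: (le_trans mass0).
have l0 : 0 < pi / 2 - gamma0 by case/andP: gamma_itv => ? ?; lra.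
rewrite /arc_mass -(mass_arc_itg _ _ _ _ _ KS suppg)//.
rewrite /initial_mass /mass /Lplus le_eqVlt; apply/orP; left; apply/eqP.
by apply: eq_Rintegral => p _; rewrite (KS_initial KS).
Qed.
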